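(* Let $G$ be a non-abelian, simply connected solvable Lie group of dimension four endowed with a bi-invariant pseudo-Riemannian metric, and let $F(G)$ denote the group of isometries of $G$ fixing the identity element. Then $F(G)$ is isomorphic to: \begin{itemize} \item $(\{1,-1\}\times\mathrm{O}(2))\ltimes\mathbb{R}^2$ for $G=G_0$, \item $(\{1,-1\}\times\mathrm{O}(1,1))\ltimes\mathbb{R}^2$ for $G=G_1$. \end{itemize} In particular, the connected component of the identity of $F(G)$ coincides with the group of inner automorphisms $\{I_g:G\to G,\ I_g(x)=gxg^{-1}\}_{g\in G}$.
   Context: $G_0$ and $G_1$ are the simply connected Lie groups with Lie algebras $\mathfrak{g}_0$ and $\mathfrak{g}_1$, respectively, where $\mathfrak{g}_i=\mathrm{span}\{e_0,e_1,e_2,e_3\}$ with non-zero brackets $$\mathfrak{g}_0:\ [e_0,e_1]=e_2,\ [e_0,e_2]=-e_1,\ [e_1,e_2]=e_3;\qquad \mathfrak{g}_1:\ [e_0,e_1]=e_1,\ [e_0,e_2]=-e_2,\ [e_1,e_2]=e_3.$$ Up to isomorphism these are the only non-abelian, simply connected solvable Lie groups of dimension four admitting a bi-invariant metric. The bi-invariant metric on $G_i$ is the one induced by the ad-invariant metric on $\mathfrak{g}_i$ for which the only non-zero products of basis vectors are (up to symmetry) $$\mathfrak{g}_0:\ \langle e_0,e_3\rangle=\langle e_1,e_1\rangle=\langle e_2,e_2\rangle=1;\qquad \mathfrak{g}_1:\ \langle e_0,e_3\rangle=\langle e_1,e_2\rangle=1,$$ the paper having observed that the ad-invariant metric can always be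 taken in this form by a change of basis. A bi-invariant metric is a pseudo-Riemannian metric invariant under left and right translations. In the semidirect products, $\mathrm{O}(2)$ is the orthogonal group of the standard inner product of $\mathbb{R}^2$, $\mathrm{O}(1,1)$ is the group of linear isometries of $\mathbb{R}^2$ with quadratic form $2xy$, and $(\varepsilon,\tilde A)$ with $\varepsilon\in\{1,-1\}$ acts on $w\in\mathbb{R}^2$ by $w\mapsto\varepsilon\tilde A w$. *)

(* Defs.v *)
From HB Require Import structures.
From mathcomp Require Import all_boot all_order all_algebra ring.
From mathcomp Require Import all_classical all_reals all_analysis.

Set Implicit Arguments.
Unset Strict Implicit.
Unset Printing Implicit Defensive.

Import Order.TTheory GRing.Theory Num.Theory.
Import numFieldNormedType.Exports.

Local Open Scope classical_set_scope.
Local Open Scope ring_scope.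

Fixpoint Ck (R : realType) (V W : normedModType R) (k : nat) (f : V -> W) : Prop :=
  if k is k'.+1 then
    (forall x, differentiable f x) /\ (forall v, Ck k' (fun x => 'd f x v))
  else continuous f.

Definition smooth (R : realType) (V W : normedModType R) (f : V -> W) : Prop :=
  forall k, Ck k f.

Section SmoothTheory.
Variables (R : realType) (V W : normedModType R).

Lemma CkS k (f : V -> W) : Ck k.+1 f -> Ck k f.
Proof.
elim: k f => [|k IH] f; first by move=> [df _] x; exact: differentiable_continuous.
by move=> [df Cf]; split=> // v; apply: IH; exact: Cf.
Qed.

Lemma Ck_cst k (a : W) : Ck k (fun _ : V => a).
Proof.
elim: k a => [|k IH] a; first exact: cst_continuous.
split=> [x|v]; first exact: differentiable_cst.
rewrite (_ : (fun x => _) = (fun=> 0)); first exact: IH.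
by apply/funext => x; rewrite (diff_cst a x).
Qed.

Lemma Ck_lin k (f : {linear V -> W}) : continuous f -> Ck k f.
Proof.
move=> cf; case: k => [//|k]; split=> [x|v]; first exact: linear_differentiable.
rewrite (_ : (fun x => _) = (fun=> f v)); first exact: Ck_cst.
by apply/funext => x; rewrite diff_lin.
Qed.

Lemma CkD k (f g : V -> W) : Ck k f -> Ck k g -> Ck k (fun x => f x + g x).
Proof.
elim: k f g => [|k IH] f g; first by move=> cf cg x; exact: (cvgD (cf x) (cg x)).
move=> [df Cf] [dg Cg]; split=> [x|v]; first exact: differentiableD.
rewrite (_ : (fun x => _) = (fun x => 'd f x v + 'd g x v)); first exact: (IH _ _ (Cf v) (Cg v)).
by apply/funext => x; rewrite (diffD (df x) (dg x)).
Qed.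

Lemma CkZl k (f : V -> R) (w : W) : Ck k f -> Ck k (fun x => f x *: w).
Proof.
elim: k f => [|k IH] f; first by move=> cf x; exact: (cvgZ (cf x) (cvg_cst w)).
move=> [df Cf]; split=> [x|v]; first exact: differentiableZl.
rewrite (_ : (fun x => _) = (fun x => 'd f x v *: w)); first exact: (IH _ (Cf v)).
by apply/funext => x; rewrite (diffZl w (df x)).
Qed.

End SmoothTheory.

Section SmoothTheoryR.
Variables (R : realType) (V : normedModType R).
Implicit Types f g : V -> R.

Lemma Ck_sum (W : normedModType R) k (I : Type) (s : seq I) (f : I -> V -> W) :
  (forall i, Ck k (f i)) -> Ck k (fun x => \sum_(i <- s) f i x).
Proof.
move=> Cf; elim: s => [|i s IH].
  by under eq_fun do rewrite big_nil; exact: Ck_cst.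
by under eq_fun do rewrite big_cons; exact: CkD.
Qed.

Lemma Ck_mx k m n (f : V -> 'M[R]_(m, n)) :
  (forall i j, Ck k (fun x => f x i j)) -> Ck k f.
Proof.
move=> Cf; rewrite (_ : f = fun x => \sum_i \sum_j f x i j *: delta_mx i j).
  by apply: Ck_sum => i; apply: Ck_sum => j; exact: CkZl.
by apply/funext => x; exact: matrix_sum_delta.
Qed.

Lemma CkM k f g : Ck k f -> Ck k g -> Ck k (fun x => f x * g x).
Proof.
elim: k f g => [|k IH] f g; first by move=> cf cg x; exact: (cvgM (cf x) (cg x)).
move=> Cf Cg; have [df Cdf] := Cf; have [dg Cdg] := Cg.
split=> [x|v]; first exact: differentiableM.
rewrite (_ : (fun x => _) = (fun x => f x * 'd g x v + g x * 'd f x v)).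
  by apply: CkD; apply: IH; [exact: CkS|exact: Cdg|exact: CkS|exact: Cdf].
by apply/funext => x; rewrite (diffM (df x) (dg x)).
Qed.

Lemma CkN k f : Ck k f -> Ck k (fun x => - f x).
Proof.
move=> Cf; rewrite (_ : (fun x => _) = (fun x => f x * -1)).
  by apply: CkM => //; exact: Ck_cst.
by apply/funext => x; rewrite mulrN1.
Qed.

Lemma diff_comp1 (h : R -> R) (h' : R) f x v :
  differentiable f x -> is_derive (f x) 1 h h' ->
  differentiable (fun y => h (f y)) x /\ 'd (fun y => h (f y)) x v = h' * 'd f x v.
Proof.
move=> df hh'.
have dh : differentiable h (f x) by apply/derivable1_diffP; exact: ex_derive.
split; first exact: differentiable_comp.
rewrite (diff_comp df dh) /= diff1E // derive1E derive_val.
by rewrite [LHS]mulrC.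
Qed.

Lemma Ck_expR k f : Ck k f -> Ck k (fun x => expR (f x)).
Proof.
elim: k => [|k IH] Cf; first by move=> x; apply: continuous_comp; [exact: Cf|exact: continuous_expR].
have [df Cdf] := Cf.
have dE x v := @diff_comp1 expR _ f x v (df x) (is_derive_expR (f x)).
split=> [x|v]; first exact: (dE x 0).1.
under eq_fun do rewrite (dE _ v).2.
by apply: CkM; [apply: IH; exact: CkS|exact: Cdf].
Qed.

Lemma Ck_cos_sin k f :
  Ck k f -> Ck k (fun x => cos (f x)) /\ Ck k (fun x => sin (f x)).
Proof.
elim: k => [|k IH] Cf.
  split=> x; (apply: continuous_comp; first exact: Cf).
    exact: continuous_cos.
  exact: continuous_sin.
have [df Cdf] := Cf; have [Cc Cs] := IH (CkS Cf).
have dc x v := @diff_comp1 cos _ f x v (df x) (is_derive_cos (f x)).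
have ds x v := @diff_comp1 sin _ f x v (df x) (is_derive_sin (f x)).
split; split=> [x|v].
- exact: (dc x 0).1.
- by under eq_fun do rewrite (dc _ v).2; apply: CkM; [exact: CkN|exact: Cdf].
- exact: (ds x 0).1.
- by under eq_fun do rewrite (ds _ v).2; apply: CkM => //; exact: Cdf.
Qed.

Lemma Ck_cos k f : Ck k f -> Ck k (fun x => cos (f x)).
Proof. by move=> /Ck_cos_sin[]. Qed.

Lemma Ck_sin k f : Ck k f -> Ck k (fun x => sin (f x)).
Proof. by move=> /Ck_cos_sin[]. Qed.

End SmoothTheoryR.

Section SmoothCoord.
Variable R : realType.

Lemma Ck_coord k m n i j : Ck k (fun x : 'M[R]_(m, n) => x i j).
Proof.
have L : linear (fun x : 'M[R]_(m, n) => x i j : R) by move=> a x y; rewrite !mxE.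
pose l : {linear 'M[R]_(m, n) -> R} :=
  HB.pack (fun x : 'M[R]_(m, n) => x i j : R) (GRing.isLinear.Build _ _ _ _ _ L).
exact: (@Ck_lin _ _ _ _ l (@coord_continuous _ _ _ i j)).
Qed.

Lemma Ck_fst_coord k n j : Ck k (fun x : 'rV[R]_n * 'rV[R]_n => x.1 0 j).
Proof.
have L : linear (fun x : 'rV[R]_n * 'rV[R]_n => x.1 0 j : R) by move=> a x y; rewrite !mxE.
pose l : {linear ('rV[R]_n * 'rV[R]_n)%type -> R} :=
  HB.pack (fun x : 'rV[R]_n * 'rV[R]_n => x.1 0 j : R) (GRing.isLinear.Build _ _ _ _ _ L).
apply: (@Ck_lin _ _ _ _ l) => x.
by apply: (@continuous_comp _ _ _ fst (fun y : 'rV[R]_n => y 0 j)); [exact: cvg_fst|exact: coord_continuous].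
Qed.

Lemma Ck_snd_coord k n j : Ck k (fun x : 'rV[R]_n * 'rV[R]_n => x.2 0 j).
Proof.
have L : linear (fun x : 'rV[R]_n * 'rV[R]_n => x.2 0 j : R) by move=> a x y; rewrite !mxE.
pose l : {linear ('rV[R]_n * 'rV[R]_n)%type -> R} :=
  HB.pack (fun x : 'rV[R]_n * 'rV[R]_n => x.2 0 j : R) (GRing.isLinear.Build _ _ _ _ _ L).
apply: (@Ck_lin _ _ _ _ l) => x.
by apply: (@continuous_comp _ _ _ snd (fun y : 'rV[R]_n => y 0 j)); [exact: cvg_snd|exact: coord_continuous].
Qed.

End SmoothCoord.

(* Lie groups whose underlying manifold is diffeomorphic to R^n, written in a
   global chart.  Every simply connected solvable Lie group is of this kind.
   Tangent spaces are identified with R^n by the chart. *)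
Record lieGroup (R : realType) (n : nat) := LieGroup {
  lmul : 'rV[R]_n -> 'rV[R]_n -> 'rV[R]_n ;
  linv : 'rV[R]_n -> 'rV[R]_n ;
  lone : 'rV[R]_n ;
  lmulA : forall x y z, lmul x (lmul y z) = lmul (lmul x y) z ;
  lmul1 : forall x, lmul lone x = x ;
  lmulV : forall x, lmul (linv x) x = lone ;
  smooth_lmul : smooth (fun xy : 'rV[R]_n * 'rV[R]_n => lmul xy.1 xy.2) ;
  smooth_linv : smooth linv }.

Definition lie_isomorphic (R : realType) (n : nat) (G H : lieGroup R n) : Prop :=
  exists (phi psi : 'rV[R]_n -> 'rV[R]_n),
    [/\ smooth phi, smooth psi, cancel phi psi, cancel psi phi &
        forall x y, phi (lmul G x y) = lmul H (phi x) (phi y)].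

Section LieAlgebra.
Variables (R : realType) (n : nat) (G : lieGroup R n).

Definition left_field (X : 'rV[R]_n) : 'rV[R]_n -> 'rV[R]_n :=
  fun p => 'd (lmul G p) (lone G) X.

(* value at the identity of [X^L, Y^L] = D_(X^L) Y^L - D_(Y^L) X^L *)
Definition lie_bracket (X Y : 'rV[R]_n) : 'rV[R]_n :=
  'd (left_field Y) (lone G) X - 'd (left_field X) (lone G) Y.

End LieAlgebra.

Section Metric.
Variables (R : realType) (n : nat).
Implicit Types (g : 'rV[R]_n -> 'M[R]_n) (f : 'rV[R]_n -> 'rV[R]_n).

(* g p is the Gram matrix, in the chart, of the metric at the point p *)
Definition inner g (p X Y : 'rV[R]_n) : R := (X *m g p *m Y^T) 0 0.

Definition pseudo_riemannian g : Prop :=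
  smooth g /\ forall p, (g p)^T = g p /\ g p \in unitmx.

Definition preserves_metric g f : Prop :=
  forall p X Y, inner g (f p) ('d f p X) ('d f p Y) = inner g p X Y.

Definition isometry g f : Prop :=
  preserves_metric g f /\
  exists f', [/\ smooth f, smooth f', cancel f f' & cancel f' f].

Definition bi_invariant_metric (G : lieGroup R n) g : Prop :=
  pseudo_riemannian g /\
  forall a, preserves_metric g (fun x => lmul G a x) /\
            preserves_metric g (fun x => lmul G x a).

(* The isometries fixing the identity, with the compact-open topology, which is
   the usual topology of an isometry group. *)
Definition isotropy (G : lieGroup R n) g :
    set {compact-open, 'rV[R]_n -> 'rV[R]_n} :=
  [set f | isometry g f /\ f (lone G) = lone G].

Definition inner_automorphisms (G : lieGroup R n) :
    set {compact-open, 'rV[R]_n -> 'rV[R]_n} :=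
  [set f | exists a, f = fun x => lmul G (lmul G a x) (linv G a)].

End Metric.

Definition compose (R : realType) (n : nat)
    (f g : {compact-open, 'rV[R]_n -> 'rV[R]_n}) :
    {compact-open, 'rV[R]_n -> 'rV[R]_n} :=
  f \o g.

(* Here a group is a subset A of T closed under mulA, with the subspace topology. *)
Definition topological_group_isomorphic (T U : topologicalType)
    (A : set T) (mulA : T -> T -> T) (B : set U) (mulB : U -> U -> U) : Prop :=
  exists (phi : T -> U) (psi : U -> T),
    [/\ set_fun A B phi, set_fun B A psi,
        {in A, cancel phi psi} & {in B, cancel psi phi}] /\
    [/\ {in A &, {morph phi : x y / mulA x y >-> mulB x y}},
        {within A, continuous phi} & {within B, continuous psi}].

Section Semidirect.
Variable R : realType.

Definition O2 : set 'M[R]_2 := [set A | A^T *m A = 1%:M].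

Definition q11 (w : 'cV[R]_2) : R := 2 * w 0 0 * w 1 0.

Definition O11 : set 'M[R]_2 :=
  [set A | A \in unitmx /\ forall w, q11 (A *m w) = q11 w].

(* ({1, -1} x O) |>< R^2, where (eps, A) acts on w by w |-> eps A w *)
Definition semidirect (O : set 'M[R]_2) : set (R * 'M[R]_2 * 'cV[R]_2) :=
  [set x | (x.1.1 = 1 \/ x.1.1 = -1) /\ O x.1.2].

Definition semidirect_mul (x y : R * 'M[R]_2 * 'cV[R]_2) :
    R * 'M[R]_2 * 'cV[R]_2 :=
  (x.1.1 * y.1.1, x.1.2 *m y.1.2, x.2 + x.1.1 *: (x.1.2 *m y.2)).

End Semidirect.

Section Groups.
Variable R : realType.

(* the point of R^4 with coordinates a, b, c, d with respect to e0, e1, e2, e3 *)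
Definition vec4 (a b c d : R) : 'rV[R]_4 := \row_i [:: a; b; c; d]`_i.

Lemma vec4E0 a b c d : vec4 a b c d 0 0 = a. Proof. by rewrite mxE. Qed.
Lemma vec4E1 a b c d : vec4 a b c d 0 1 = b. Proof. by rewrite mxE. Qed.
Lemma vec4E2 a b c d : vec4 a b c d 0 2 = c. Proof. by rewrite mxE. Qed.
Lemma vec4E3 a b c d : vec4 a b c d 0 3 = d. Proof. by rewrite mxE. Qed.
Definition vec4E := (vec4E0, vec4E1, vec4E2, vec4E3).

Lemma vec4_eta (x : 'rV[R]_4) : x = vec4 (x 0 0) (x 0 1) (x 0 2) (x 0 3).
Proof.
by apply/rowP => -[[|[|[|[|//]]]] i4]; rewrite !mxE /=; congr (x _ _); exact: val_inj.
Qed.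

Lemma smooth_vec4 (V : normedModType R) (a b c d : V -> R) :
  smooth a -> smooth b -> smooth c -> smooth d ->
  smooth (fun x => vec4 (a x) (b x) (c x) (d x)).
Proof.
move=> sa sb sc sd k; apply: Ck_mx => i -[[|[|[|[|//]]]] j4].
- by under eq_fun do rewrite mxE; exact: sa.
- by under eq_fun do rewrite mxE; exact: sb.
- by under eq_fun do rewrite mxE; exact: sc.
- by under eq_fun do rewrite mxE; exact: sd.
Qed.

(* In both groups (t, v, z) (t', v', z') =
   (t + t', v + rho t v', z + z' + (v /\ rho t v') / 2), where rho t is
   exp (t ad e0) on span (e1, e2): a rotation for G0, diag (e^t, e^-t) for G1. *)
Definition mul0 (x y : 'rV[R]_4) : 'rV[R]_4 :=
  let t := x 0 0 in
  let v1 := cos t * y 0 1 - sin t * y 0 2 in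
  let v2 := sin t * y 0 1 + cos t * y 0 2 in
  vec4 (t + y 0 0) (x 0 1 + v1) (x 0 2 + v2)
       (x 0 3 + y 0 3 + 2^-1 * (x 0 1 * v2 - x 0 2 * v1)).

Definition inv0 (x : 'rV[R]_4) : 'rV[R]_4 :=
  let t := x 0 0 in
  vec4 (- t) (- (cos t * x 0 1 + sin t * x 0 2))
       (sin t * x 0 1 - cos t * x 0 2) (- x 0 3).

Definition mul1 (x y : 'rV[R]_4) : 'rV[R]_4 :=
  let t := x 0 0 in
  let v1 := expR t * y 0 1 in
  let v2 := expR (- t) * y 0 2 in
  vec4 (t + y 0 0) (x 0 1 + v1) (x 0 2 + v2)
       (x 0 3 + y 0 3 + 2^-1 * (x 0 1 * v2 - x 0 2 * v1)).

Definition inv1 (x : 'rV[R]_4) : 'rV[R]_4 :=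
  let t := x 0 0 in
  vec4 (- t) (- (expR (- t) * x 0 1)) (- (expR t * x 0 2)) (- x 0 3).

Lemma mul0A x y z : mul0 x (mul0 y z) = mul0 (mul0 x y) z.
Proof.
rewrite /mul0 /= !vec4E cosD sinD; congr vec4; try ring.
have cs := cos2Dsin2 (x 0 0).
have -> : y 0 1 * (sin (y 0 0) * z 0 1 + cos (y 0 0) * z 0 2) -
          y 0 2 * (cos (y 0 0) * z 0 1 - sin (y 0 0) * z 0 2) =
  (cos (x 0 0) ^+ 2 + sin (x 0 0) ^+ 2) *
  (y 0 1 * (sin (y 0 0) * z 0 1 + cos (y 0 0) * z 0 2) -
          y 0 2 * (cos (y 0 0) * z 0 1 - sin (y 0 0) * z 0 2)).
  by rewrite cs mul1r.
ring.
Qed.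

Lemma mul01 x : mul0 0 x = x.
Proof.
rewrite [RHS]vec4_eta /mul0 !mxE cos0 sin0; congr vec4; ring.
Qed.

Lemma mul0V x : mul0 (inv0 x) x = 0.
Proof.
rewrite /mul0 /inv0 /= !vec4E cosN sinN [RHS]vec4_eta !mxE; congr vec4; ring.
Qed.

Lemma mul1A x y z : mul1 x (mul1 y z) = mul1 (mul1 x y) z.
Proof.
rewrite /mul1 /= !vec4E opprD !expRD; congr vec4; try ring.
have cs := expRxMexpNx_1 (x 0 0).
have -> : y 0 1 * (expR (- y 0 0) * z 0 2) - y 0 2 * (expR (y 0 0) * z 0 1) =
  (expR (x 0 0) * expR (- x 0 0)) *
  (y 0 1 * (expR (- y 0 0) * z 0 2) - y 0 2 * (expR (y 0 0) * z 0 1)).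
  by rewrite cs mul1r.
ring.
Qed.

Lemma mul11 x : mul1 0 x = x.
Proof.
rewrite [RHS]vec4_eta /mul1 !mxE oppr0 expR0; congr vec4; ring.
Qed.

Lemma mul1V x : mul1 (inv1 x) x = 0.
Proof.
rewrite /mul1 /inv1 /= !vec4E opprK [RHS]vec4_eta !mxE; congr vec4; ring.
Qed.

Ltac solve_Ck := move=> k; repeat first
  [ exact: Ck_coord | exact: Ck_fst_coord | exact: Ck_snd_coord | exact: Ck_cst
  | apply: CkD | apply: CkM | apply: CkN | apply: Ck_expR | apply: Ck_cos
  | apply: Ck_sin ].

Lemma smooth_mul0 : smooth (fun xy : 'rV[R]_4 * 'rV[R]_4 => mul0 xy.1 xy.2).
Proof. by apply: smooth_vec4; solve_Ck. Qed.

Lemma smooth_inv0 : smooth inv0.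
Proof. by apply: smooth_vec4; solve_Ck. Qed.

Lemma smooth_mul1 : smooth (fun xy : 'rV[R]_4 * 'rV[R]_4 => mul1 xy.1 xy.2).
Proof. by apply: smooth_vec4; solve_Ck. Qed.

Lemma smooth_inv1 : smooth inv1.
Proof. by apply: smooth_vec4; solve_Ck. Qed.

Definition G0 : lieGroup R 4 := LieGroup mul0A mul01 mul0V smooth_mul0 smooth_inv0.
Definition G1 : lieGroup R 4 := LieGroup mul1A mul11 mul1V smooth_mul1 smooth_inv1.

Definition has_diff (V W : normedModType R) (f : V -> W) x v d :=
  differentiable f x /\ 'd f x v = d.

Section HasDiff.
Variables (V : normedModType R) (x v : V).
Implicit Types f g : V -> R.

Lemma has_diff_cst a : has_diff (fun _ => a : R) x v 0.
Proof. by split; [exact: differentiable_cst|rewrite (diff_cst a x)]. Qed.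

Lemma has_diffD (W : normedModType R) (f g : V -> W) a b :
  has_diff f x v a -> has_diff g x v b ->
  has_diff (fun x => f x + g x) x v (a + b).
Proof.
by move=> [df <-] [dg <-]; split; [exact: differentiableD|rewrite (diffD df dg)].
Qed.

Lemma has_diffZl (W : normedModType R) f a (w : W) :
  has_diff f x v a -> has_diff (fun x => f x *: w) x v (a *: w).
Proof.
by move=> [df <-]; split; [exact: differentiableZl|rewrite (diffZl w df)].
Qed.

Lemma has_diffM f g a b : has_diff f x v a -> has_diff g x v b ->
  has_diff (fun x => f x * g x) x v (f x * b + g x * a).
Proof.
by move=> [df <-] [dg <-]; split; [exact: differentiableM|rewrite (diffM df dg)].
Qed.

Lemma has_diffN f a : has_diff f x v a -> has_diff (fun x => - f x) x v (- a).
Proof.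
by move=> [df <-]; split; [exact: differentiableN|rewrite (diffN df)].
Qed.

Lemma has_diff_expR f a : has_diff f x v a ->
  has_diff (fun x => expR (f x)) x v (expR (f x) * a).
Proof. by move=> [df <-]; exact: (diff_comp1 v df (is_derive_expR _)). Qed.

Lemma has_diff_cos f a : has_diff f x v a ->
  has_diff (fun x => cos (f x)) x v (- sin (f x) * a).
Proof. by move=> [df <-]; exact: (diff_comp1 v df (is_derive_cos _)). Qed.

Lemma has_diff_sin f a : has_diff f x v a ->
  has_diff (fun x => sin (f x)) x v (cos (f x) * a).
Proof. by move=> [df <-]; exact: (diff_comp1 v df (is_derive_sin _)). Qed.

End HasDiff.

Lemma has_diff_coord n (x v : 'rV[R]_n) j : has_diff (fun y : 'rV[R]_n => y 0 j : R) x v (v 0 j).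
Proof.
have L : linear (fun x : 'rV[R]_n => x 0 j : R) by move=> a y z; rewrite !mxE.
pose l : {linear 'rV[R]_n -> R} :=
  HB.pack (fun x : 'rV[R]_n => x 0 j : R) (GRing.isLinear.Build _ _ _ _ _ L).
have cl : continuous l by exact: coord_continuous.
by split; [exact: (linear_differentiable x cl)|rewrite (diff_lin x cl)].
Qed.

Lemma diff_vec4 (V : normedModType R) (f1 f2 f3 f4 : V -> R) x v a b c d :
  has_diff f1 x v a -> has_diff f2 x v b -> has_diff f3 x v c -> has_diff f4 x v d ->
  'd (fun x => vec4 (f1 x) (f2 x) (f3 x) (f4 x)) x v = vec4 a b c d.
Proof.
move=> h1 h2 h3 h4.
have E (y : V) : vec4 (f1 y) (f2 y) (f3 y) (f4 y) =
    f1 y *: vec4 1 0 0 0 + f2 y *: vec4 0 1 0 0 +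
    (f3 y *: vec4 0 0 1 0 + f4 y *: vec4 0 0 0 1).
  by rewrite [RHS]vec4_eta !mxE /=; congr vec4; ring.
under eq_fun do rewrite E.
have [_ ->] := has_diffD
  (has_diffD (has_diffZl (vec4 1 0 0 0) h1) (has_diffZl (vec4 0 1 0 0) h2))
  (has_diffD (has_diffZl (vec4 0 0 1 0) h3) (has_diffZl (vec4 0 0 0 1) h4)).
by rewrite [LHS]vec4_eta !mxE /=; congr vec4; ring.
Qed.

Ltac solve_diff := repeat first
  [ exact: has_diff_coord | exact: has_diff_cst
  | apply: has_diffD | apply: has_diffM | apply: has_diffN
  | apply: has_diff_expR | apply: has_diff_cos | apply: has_diff_sin ].

Lemma left_field0 (X p : 'rV[R]_4) :
  left_field G0 X p =
  let v1 := cos (p 0 0) * X 0 1 - sin (p 0 0) * X 0 2 in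
  let v2 := sin (p 0 0) * X 0 1 + cos (p 0 0) * X 0 2 in
  vec4 (X 0 0) v1 v2 (X 0 3 + 2^-1 * (p 0 1 * v2 - p 0 2 * v1)).
Proof.
rewrite /left_field /= /mul0 /=.
erewrite diff_vec4; [|solve_diff..].
by rewrite /= !mxE; congr vec4; ring.
Qed.

Lemma left_field1 (X p : 'rV[R]_4) :
  left_field G1 X p =
  let v1 := expR (p 0 0) * X 0 1 in
  let v2 := expR (- p 0 0) * X 0 2 in
  vec4 (X 0 0) v1 v2 (X 0 3 + 2^-1 * (p 0 1 * v2 - p 0 2 * v1)).
Proof.
rewrite /left_field /= /mul1 /=.
erewrite diff_vec4; [|solve_diff..].
by rewrite /= !mxE; congr vec4; ring.
Qed.

Lemma lie_bracket0 (X Y : 'rV[R]_4) :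
  lie_bracket G0 X Y =
  vec4 0 (X 0 2 * Y 0 0 - X 0 0 * Y 0 2) (X 0 0 * Y 0 1 - X 0 1 * Y 0 0)
       (X 0 1 * Y 0 2 - X 0 2 * Y 0 1).
Proof.
rewrite /lie_bracket.
have -> : left_field G0 X = _ := funext (left_field0 X).
have -> : left_field G0 Y = _ := funext (left_field0 Y).
erewrite diff_vec4; [|solve_diff..].
erewrite diff_vec4; [|solve_diff..].
by rewrite [LHS]vec4_eta !mxE /= ?mxE cos0 sin0; congr vec4; field.
Qed.

Lemma lie_bracket1 (X Y : 'rV[R]_4) :
  lie_bracket G1 X Y =
  vec4 0 (X 0 0 * Y 0 1 - X 0 1 * Y 0 0) (X 0 2 * Y 0 0 - X 0 0 * Y 0 2)
       (X 0 1 * Y 0 2 - X 0 2 * Y 0 1).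
Proof.
rewrite /lie_bracket.
have -> : left_field G1 X = _ := funext (left_field1 X).
have -> : left_field G1 Y = _ := funext (left_field1 Y).
erewrite diff_vec4; [|solve_diff..].
erewrite diff_vec4; [|solve_diff..].
by rewrite [LHS]vec4_eta !mxE /= ?mxE oppr0 expR0; congr vec4; field.
Qed.

Definition mx4 (s : seq (seq R)) : 'M[R]_4 := \matrix_(i, j) (nth [::] s i)`_j.

(* The bi-invariant metrics extending the given ad-invariant products on the Lie
   algebras: at p = 0, <e0, e3> = <e1, e1> = <e2, e2> = 1 for metric0 and
   <e0, e3> = <e1, e2> = 1 for metric1. *)
Definition metric0 (p : 'rV[R]_4) : 'M[R]_4 :=
  let a := 2^-1 * p 0 2 in let b := - (2^-1 * p 0 1) in
  mx4 [:: [:: 0; a; b; 1]; [:: a; 1; 0; 0]; [:: b; 0; 1; 0]; [:: 1; 0; 0; 0]].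

Definition metric1 (p : 'rV[R]_4) : 'M[R]_4 :=
  let a := 2^-1 * p 0 2 in let b := - (2^-1 * p 0 1) in
  mx4 [:: [:: 0; a; b; 1]; [:: a; 0; 1; 0]; [:: b; 1; 0; 0]; [:: 1; 0; 0; 0]].

Lemma inner0E p a b c d a' b' c' d' :
  inner metric0 p (vec4 a b c d) (vec4 a' b' c' d') =
  a * d' + d * a' + b * b' + c * c' +
  2^-1 * (p 0 2 * (a * b' + b * a') - p 0 1 * (a * c' + c * a')).
Proof.
rewrite /inner /metric0 mxE !big_ord_recl big_ord0 !mxE !big_ord_recl !big_ord0.
by rewrite !mxE /=; ring.
Qed.

Lemma inner1E p a b c d a' b' c' d' :
  inner metric1 p (vec4 a b c d) (vec4 a' b' c' d') =
  a * d' + d * a' + b * c' + c * b' +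
  2^-1 * (p 0 2 * (a * b' + b * a') - p 0 1 * (a * c' + c * a')).
Proof.
rewrite /inner /metric1 mxE !big_ord_recl big_ord0 !mxE !big_ord_recl !big_ord0.
by rewrite !mxE /=; ring.
Qed.

Lemma smooth_metric0 : smooth metric0.
Proof.
move=> k; apply: Ck_mx => -[[|[|[|[|//]]]] i4] [[|[|[|[|//]]]] j4];
  under eq_fun do rewrite mxE /=;
  by repeat first [exact: Ck_cst | exact: Ck_coord | apply: CkN | apply: CkM].
Qed.

Lemma smooth_metric1 : smooth metric1.
Proof.
move=> k; apply: Ck_mx => -[[|[|[|[|//]]]] i4] [[|[|[|[|//]]]] j4];
  under eq_fun do rewrite mxE /=;
  by repeat first [exact: Ck_cst | exact: Ck_coord | apply: CkN | apply: CkM].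
Qed.

Lemma bi_invariant_metric0 : bi_invariant_metric G0 metric0.
Proof.
split; first split.
- exact: smooth_metric0.
- move=> p; split.
    by apply/matrixP => -[[|[|[|[|//]]]] i4] [[|[|[|[|//]]]] j4]; rewrite !mxE.
  pose a := 2^-1 * p 0 2; pose b := - (2^-1 * p 0 1).
  suff /mulmx1_unit[] : metric0 p *m mx4 [:: [:: 0; 0; 0; 1]; [:: 0; 1; 0; - a];
    [:: 0; 0; 1; - b]; [:: 1; - a; - b; a ^+ 2 + b ^+ 2]] = 1%:M by [].
  apply/matrixP => -[[|[|[|[|//]]]] i4] [[|[|[|[|//]]]] j4];
  by rewrite mxE !big_ord_recl big_ord0 !mxE /= -/a -/b; ring.
- move=> q; split=> p X Y; rewrite (vec4_eta X) (vec4_eta Y) /= /mul0 /=.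
    do 2 (erewrite diff_vec4; [|solve_diff..]).
    rewrite !inner0E /= !vec4E.
    have := cos2Dsin2 (q 0 0) => /(congr1 (fun z => z - sin (q 0 0) ^+ 2)).
    rewrite addrK.
    set c := cos _; set s := sin _ => cs.
    ring: cs.
  do 2 (erewrite diff_vec4; [|solve_diff..]).
  rewrite !inner0E /= !vec4E.
  have := cos2Dsin2 (p 0 0) => /(congr1 (fun z => z - sin (p 0 0) ^+ 2)).
  rewrite addrK.
  set c := cos _; set s := sin _ => cs.
  by field: cs.
Qed.

Lemma bi_invariant_metric1 : bi_invariant_metric G1 metric1.
Proof.
split; first split.
- exact: smooth_metric1.
- move=> p; split.
    by apply/matrixP => -[[|[|[|[|//]]]] i4] [[|[|[|[|//]]]] j4]; rewrite !mxE.
  pose a := 2^-1 * p 0 2; pose b := - (2^-1 * p 0 1).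
  suff /mulmx1_unit[] : metric1 p *m mx4 [:: [:: 0; 0; 0; 1]; [:: 0; 0; 1; - b];
    [:: 0; 1; 0; - a]; [:: 1; - b; - a; 2 * a * b]] = 1%:M by [].
  apply/matrixP => -[[|[|[|[|//]]]] i4] [[|[|[|[|//]]]] j4];
  by rewrite mxE !big_ord_recl big_ord0 !mxE /= -/a -/b; ring.
- move=> q; split=> p X Y; rewrite (vec4_eta X) (vec4_eta Y) /= /mul1 /=.
    do 2 (erewrite diff_vec4; [|solve_diff..]).
    rewrite !inner1E /= !vec4E.
    have := expRxMexpNx_1 (q 0 0).
    set c := expR _; set s := expR _ => cs.
    by ring: cs.
  do 2 (erewrite diff_vec4; [|solve_diff..]).
  rewrite !inner1E /= !vec4E.
  have := expRxMexpNx_1 (p 0 0).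
  set c := expR _; set s := expR _ => cs.
  by field: cs.
Qed.

End Groups.

(* Main.v *)
Require Import Defs.
From mathcomp Require Import all_boot all_order all_algebra ring lra.
From mathcomp Require Import all_classical all_reals all_analysis.

(* The coordinates of [brinkmann0] and [brinkmann1] turn every bi-invariant
   metric on the group into a multiple of a Cahen-Wallach plane wave
     2 dt dz + B(dw, dw) + k B(w, w) dt^2,   w in R^2,
   with k = -1/4, B definite for G0 and k = 1/4, B indefinite for G1.  An
   isometry f preserves the Levi-Civita connection, so its second differential
   is determined by its first one.  For the coordinate t o f this forces, by
   integration along lines, that t o f = a t with a constant; for w o f it gives
   a = 1 or a = -1 and w o f = M w + beta(t), with M a linear isometry of B and
   beta'' = k beta, beta(0) = 0, that is beta(t) = S(a t) b where S solves
   S'' = k S, S(0) = 0, S'(0) = 1.  The metric then determines z o f.  Hence f is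
   given by (a, M, b), and composition is the law of the semidirect product.
   On the identity component a = 1 and M is a rotation or a boost, and such
   triples are those of the inner automorphisms. *)

Set Implicit Arguments.
Unset Strict Implicit.
Unset Printing Implicit Defensive.

Import Order.TTheory GRing.Theory Num.Theory.
Import numFieldNormedType.Exports.

Local Open Scope classical_set_scope.
Local Open Scope ring_scope.

(** * Smooth maps *)

(** Two devices carry the rigidity. The second-differential law is tested against the preimage U of
    [ez], because pairing with [ez] reads off the t coordinate and the Christoffel term at the image
    vanishes; only once t o f = a t is known can the law be tested against transverse vectors.
    Unwanted terms are then excluded by translation: the differential applied to [et] turns out
    unchanged under transverse shifts, so its derivative is too, whereas the law makes that
    derivative depend linearly on the transverse position, with a factor k. Here k != 0 is decisive.
    No Lie group structure on the isotropy group is presupposed. Its topology enters through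
    evaluation at finitely many points, which recovers (a, M, b), and through currying for the
    inverse map. The identity component is bounded from above by continuous functions of the
    parameters that never vanish, and from below by paths of inner automorphisms. Since the metric
    is arbitrary, Ad-invariance at a few group elements is used to show that it is a constant times
    the reference metric plus a multiple of dt^2. *)

Section Differentials.
Variable R : realType.
Implicit Types U V W : normedModType R.

Lemma has_diffP V W (f : V -> W) x v :
  differentiable f x -> has_diff f x v ('d f x v).
Proof. by []. Qed.

Lemma has_diff_id V (x v : V) : has_diff (fun y : V => y) x v v.
Proof.
have cid : continuous (idfun : V -> V) by move=> y; exact: cvg_id.
by split; [exact: (linear_differentiable x cid)|rewrite (diff_lin x cid)].
Qed.

Lemma has_diff_comp U V W (f : U -> V) (g : V -> W) x v a :
  has_diff f x v a -> differentiable g (f x) ->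
  has_diff (fun y => g (f y)) x v ('d g (f x) a).
Proof.
move=> [df <-] dg; split; first exact: differentiable_comp.
by rewrite (diff_comp df dg).
Qed.

Lemma diff_compE U V W (f : U -> V) (g : V -> W) x v :
  differentiable f x -> differentiable g (f x) ->
  'd (fun y => g (f y)) x v = 'd g (f x) ('d f x v).
Proof. by move=> df dg; have [_ ->] := has_diff_comp (has_diffP v df) dg. Qed.

Lemma has_diff_shift V (c p v : V) : has_diff (fun q : V => q + c) p v v.
Proof.
have [di Ei] := has_diff_id p v.
have dc : differentiable (fun _ : V => c) p by exact: differentiable_cst.
split; first exact: (@differentiableD _ _ _ (fun q => q) (fun _ => c)).
by rewrite (diffD di dc) /= Ei (diff_cst c) addr0.
Qed.

Lemma has_diff_line V (p X : V) (s : R) : has_diff (fun r : R => p + r *: X) s 1 X.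
Proof.
have hid := has_diff_id s (1 : R).
split.
  by apply: differentiableD; [exact: differentiable_cst|exact: differentiableZl].
have dc : differentiable (fun _ : R => p) s by exact: differentiable_cst.
have [dl El] := has_diffZl X hid.
rewrite (diffD dc dl) /= El scale1r.
by rewrite (_ : 'd (fun _ : R => p) s 1 = 0) ?add0r// (diff_cst p s).
Qed.

Lemma is_derive_has_diff (h : R -> R) s d : has_diff h s 1 d -> is_derive s 1 h d.
Proof.
by move=> [dh <-]; split; [exact/derivable1_diffP|rewrite deriveE].
Qed.

Lemma is_derive_line V (f : V -> R) (p X : V) (s : R) :
  differentiable f (p + s *: X) ->
  is_derive s 1 (fun r : R => f (p + r *: X)) ('d f (p + s *: X) X).
Proof.
move=> df; apply: is_derive_has_diff.
exact: (@has_diff_comp _ _ _ _ f s 1 X (has_diff_line p X s) df).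
Qed.

Lemma line_MVT V (f : V -> R) (p X : V) (s : R) : 0 < s ->
  (forall x, differentiable f x) ->
  exists2 c, 0 < c < s & f (p + s *: X) - f p = s * 'd f (p + c *: X) X.
Proof.
move=> s0 df.
have [|c] := @MVT R (fun r => f (p + r *: X))
    (fun r => 'd f (p + r *: X) X) 0 s s0 (fun r _ => is_derive_line (df _)).
  apply: continuous_subspaceT => r; apply: differentiable_continuous.
  have /derivable1_diffP // := @ex_derive _ _ _ _ _ _ _ (@is_derive_line V f p X r (df _)).
rewrite in_itv /= => cs; rewrite scale0r addr0 subr0 => ->.
by exists c => //; rewrite mulrC.
Qed.

(** Integration along a line: f(p + s X) - s d has zero derivative in s, hence equal values at s = 0
    and s = 1. *)
Lemma line_cst V (f : V -> R) (p X : V) (d : R) :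
  (forall x, differentiable f x) ->
  (forall s : R, 'd f (p + s *: X) X = d) -> f (p + X) = f p + d.
Proof.
move=> df dfX.
pose h (s : R) := f (p + s *: X) - s * d.
have dh (s : R) : is_derive s 1 h 0.
  apply: is_derive_has_diff; rewrite /h -[X in has_diff _ _ _ X](subrr d).
  apply: has_diffD.
    have := @has_diff_comp _ _ _ _ f _ _ _ (has_diff_line p X s) (df _).
    by rewrite dfX.
  apply: has_diffN.
  by have := has_diffM (has_diff_id s 1) (has_diff_cst s 1 d); rewrite mulr0 add0r mulr1.
have := @is_derive_0_is_cst R h 1 0 dh.
by rewrite /h scale0r addr0 scale1r mul0r subr0 mul1r => <-; rewrite subrK.
Qed.

Lemma smooth_differentiable V W (f : V -> W) x : smooth f -> differentiable f x.
Proof. by move=> /(_ 1) [+ _] => /(_ x). Qed.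

Lemma smooth_continuous V W (f : V -> W) : smooth f -> continuous f.
Proof. by move=> /(_ 0). Qed.

Lemma smooth_diff V W (f : V -> W) v : smooth f -> smooth (fun x => 'd f x v).
Proof. by move=> sf k; have [_] := sf k.+1; exact. Qed.

Lemma has_diff_coord_comp V n (f : V -> 'rV[R]_n) x v d j :
  has_diff f x v d -> has_diff (fun y => f y 0 j : R) x v (d 0 j).
Proof.
move=> hf; have [dl El] := has_diff_coord (f x) d j.
by have := has_diff_comp hf dl; rewrite El.
Qed.

Lemma Ck_coord_comp V k n (f : V -> 'rV[R]_n) j :
  Ck k f -> Ck k (fun x => f x 0 j : R).
Proof.
elim: k f => [|k IH] f.
  move=> cf x; apply: (@continuous_comp _ _ _ f (fun y : 'rV[R]_n => y 0 j)).
    exact: cf.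
  exact: coord_continuous.
move=> [df Cf]; split=> [x|v].
  by case: (has_diff_coord_comp j (has_diffP (0 : V) (df x))).
rewrite (_ : (fun x => _) = fun x => 'd f x v 0 j); first exact/IH/Cf.
by apply/funext => x; have [] := has_diff_coord_comp j (has_diffP v (df x)).
Qed.

(** By the chain rule the outer differential is taken in a direction that varies with x, while [Ck]
    differentiates in fixed directions only. Expanding that direction in the canonical basis
    restores fixed directions, and the induction applies. *)
Lemma Ck_comp_real V k n (f : V -> 'rV[R]_n) (h : 'rV[R]_n -> R) :
  Ck k f -> Ck k h -> Ck k (fun x => h (f x)).
Proof.
elim: k h => [|k IH] h.
  by move=> cf ch x; apply: continuous_comp; [exact: cf|exact: ch].
move=> Cf Ch; have [df Cdf] := Cf; have [dh Cdh] := Ch; split=> [x|v].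
  exact: differentiable_comp.
rewrite (_ : (fun x => _) =
  fun x => \sum_i 'd f x v 0 i * 'd h (f x) (delta_mx 0 i)).
  apply: Ck_sum => i; apply: CkM; first exact/Ck_coord_comp/Cdf.
  by apply: (IH (fun y => 'd h y (delta_mx 0 i))); [exact: CkS|exact: Cdh].
apply/funext => x; rewrite (diff_compE v (df x) (dh (f x))) [in LHS](row_sum_delta ('d f x v)).
by rewrite linear_sum; apply: eq_bigr => i _; rewrite linearZ.
Qed.

Lemma Ck_comp V k n m (f : V -> 'rV[R]_n) (h : 'rV[R]_n -> 'rV[R]_m) :
  Ck k f -> Ck k h -> Ck k (fun x => h (f x)).
Proof.
move=> Cf Ch; apply: Ck_mx => i j; rewrite (ord1 i).
exact: (Ck_comp_real Cf (Ck_coord_comp j Ch)).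
Qed.

Lemma smooth_comp V n m (f : V -> 'rV[R]_n) (h : 'rV[R]_n -> 'rV[R]_m) :
  smooth f -> smooth h -> smooth (fun x => h (f x)).
Proof. by move=> sf sh k; exact: Ck_comp. Qed.

Lemma diffK V W (f : V -> W) (g : W -> V) x v :
  cancel f g -> differentiable f x -> differentiable g (f x) ->
  'd g (f x) ('d f x v) = v.
Proof.
move=> fK df dg; rewrite -diff_compE //.
rewrite (_ : (fun y => g (f y)) = id) ?(has_diff_id _ _).2//.
by apply/funext => y; rewrite fK.
Qed.

(* The second difference of [f] over the parallelogram spanned by [s X] and
   [s Y] is [s ^ 2] times a second derivative taken in either order. *)
Lemma diff_sym V (f : V -> R) p X Y : smooth f ->
  'd (fun q => 'd f q X) p Y = 'd (fun q => 'd f q Y) p X.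
Proof.
move=> sf.
have df q : differentiable f q by exact: smooth_differentiable.
have ddf Z q : differentiable (fun q => 'd f q Z) q.
  exact/smooth_differentiable/smooth_diff.
have key A B (s : R) : 0 < s -> exists c : R * R,
    [/\ 0 < c.1 < s, 0 < c.2 < s &
    f (p + s *: A + s *: B) - f (p + s *: A) - (f (p + s *: B) - f p)
    = s * (s * 'd (fun q => 'd f q A) (p + c.1 *: A + c.2 *: B) B)].
  move=> s0.
  have d1 q : differentiable (fun q => q + s *: B) q.
    by have [] := has_diff_shift (s *: B) q 0.
  have d2 q : differentiable (fun q => f (q + s *: B)) q.
    exact: (@differentiable_comp _ _ _ _ (fun q => q + s *: B) f).
  have [|c cs E] := @line_MVT V (fun q => f (q + s *: B) - f q) p A s s0.
    by move=> q; exact: differentiableB.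
  have [c' cs' E'] := @line_MVT V (fun q => 'd f q A) (p + c *: A) B s s0 (ddf A).
  exists (c, c'); split => //=; rewrite -E' E; congr (_ * _).
  rewrite (diffB (d2 _) (df _)) /= (@diff_compE _ _ _ (fun q => q + s *: B) f) //.
  congr ('d f _ _ - _).
  by rewrite (has_diff_shift _ _ _).2.
have cont A B (e : R) : 0 < e -> exists2 d : R, 0 < d & forall a b : R,
   0 < a < d -> 0 < b < d ->
   `|'d (fun q => 'd f q A) p B - 'd (fun q => 'd f q A) (p + a *: A + b *: B) B| < e.
  move=> e0.
  have cH : continuous (fun q => 'd (fun q => 'd f q A) q B).
    exact/smooth_continuous/smooth_diff/smooth_diff.
  have /cvgrPdist_lt/(_ _ e0) := cH p.
  move=> /nbhs_normP [d /= d0 Hd].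
  (* The summand 1 keeps the divisor positive when A = B = 0. *)
  have N0 : 0 < `|A| + `|B| + 1 by rewrite ltr_wpDl// addr_ge0.
  exists (d / (`|A| + `|B| + 1)); first exact: divr_gt0.
  move=> a b /andP[a0 ad] /andP[b0 bd]; apply: Hd => /=.
  rewrite -addrA opprD addNKr normrN (le_lt_trans (ler_normD _ _))// !normrZ.
  rewrite !gtr0_norm//.
  have := ler_wpM2r (normr_ge0 A) (ltW ad); have := ler_wpM2r (normr_ge0 B) (ltW bd).
  have dE : d = d / (`|A| + `|B| + 1) * `|A| + d / (`|A| + `|B| + 1) * `|B| +
               d / (`|A| + `|B| + 1).
    by rewrite -!mulrDr -[X in _ + X]mulr1 -mulrDr divfK// gt_eqF.
  have := divr_gt0 d0 N0; lra.
apply/eqP; rewrite -subr_eq0 -normr_eq0; apply/eqP/le_anti; rewrite normr_ge0 andbT.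
apply/ler_addgt0Pr => e e0; rewrite add0r.
have e20 : 0 < e / 2 by lra.
have [d1 d10 H1] := cont X Y _ e20.
have [d2 d20 H2] := cont Y X _ e20.
pose s := Num.min d1 d2 / 2.
have s0 : 0 < s by rewrite divr_gt0// lt_min d10.
have [s1 s2] : s < d1 /\ s < d2.
  have : s < Num.min d1 d2.
    have : 0 < Num.min d1 d2 by rewrite lt_min d10.
    by rewrite /s => ?; lra.
  by rewrite lt_min => /andP.
have [[a b] /= [/andP[a0 as_] /andP[b0 bs_] Eab]] := key X Y s s0.
have [[a' b'] /= [/andP[a0' as_'] /andP[b0' bs_'] Eab']] := key Y X s s0.
have {}H1 := H1 a b; have {}H2 := H2 a' b'.
rewrite a0 b0 (lt_trans as_ s1) (lt_trans bs_ s1) in H1.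
rewrite a0' b0' (lt_trans as_' s2) (lt_trans bs_' s2) in H2.
have {}H1 := H1 isT isT; have {}H2 := H2 isT isT.
(* The second difference is symmetric in X and Y, so cancelling s twice equates the two mixed
   derivatives at their intermediate points; continuity then brings both back to p. *)
have E : 'd (fun q => 'd f q X) (p + a *: X + b *: Y) Y =
         'd (fun q => 'd f q Y) (p + a' *: Y + b' *: X) X.
  apply: (mulfI (lt0r_neq0 s0)); apply: (mulfI (lt0r_neq0 s0)).
  by rewrite -Eab -Eab' (addrAC p (s *: Y)); ring.
rewrite {}E in H1; rewrite distrC in H2.
by rewrite [leRHS]splitr (le_trans (ler_distD _ _ _) (ltW (ltr_leD H1 (ltW H2)))).
Qed.

Lemma diff_sym_row V n (f : V -> 'rV[R]_n) p X Y : smooth f ->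
  'd (fun q => 'd f q X) p Y = 'd (fun q => 'd f q Y) p X.
Proof.
move=> sf; apply/rowP => j.
have df Z : (fun x => 'd f x Z 0 j) = (fun x => 'd (fun y => f y 0 j : R) x Z).
  apply/funext => x.
  by have [] := has_diff_coord_comp j (has_diffP Z (smooth_differentiable x sf)).
have E Z T : 'd (fun q => 'd f q Z) p T 0 j = 'd (fun q => 'd (fun y => f y 0 j : R) q Z) p T.
  have dd := smooth_differentiable p (smooth_diff Z sf).
  by have [_ <-] := has_diff_coord_comp j (has_diffP T dd); rewrite df.
by rewrite !E; apply: diff_sym => k; exact: Ck_coord_comp.
Qed.

End Differentials.

(** * The plane wave and its connection *)

Ltac solve_has_diff := repeat first
  [ eassumption | exact: has_diff_coord | exact: has_diff_cst
  | apply: has_diffD | apply: has_diffM | apply: has_diffN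
  | apply: has_diff_coord_comp ].

Lemma has_diff_eq (R : realType) (V : normedModType R) (f : V -> R) x v (a b : R) :
  has_diff f x v a -> a = b -> has_diff f x v b.
Proof. by move=> ? <-. Qed.

Section PlaneWave.
Variables (R : realType) (k j11 j12 j22 : R).

(* In coordinates (t, w, z), the plane wave 2 dt dz + B(dw, dw) + k B(w, w) dt^2. *)
Definition bil (x y : 'rV[R]_4) : R :=
  j11 * (x 0 1 * y 0 1) + j12 * (x 0 1 * y 0 2 + x 0 2 * y 0 1) +
  j22 * (x 0 2 * y 0 2).

Definition plane_wave (p x y : 'rV[R]_4) : R :=
  x 0 0 * y 0 3 + x 0 3 * y 0 0 + bil x y + k * bil p p * (x 0 0 * y 0 0).

Lemma plane_wave_sym p x y : plane_wave p x y = plane_wave p y x.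
Proof. by rewrite /plane_wave /bil; ring. Qed.

(** Christoffel symbols of the first kind, divided by k: only the coefficient k B(w, w) of dt^2
    varies with the point. *)
Definition christoffel (p x y u : 'rV[R]_4) : R :=
  bil p y * (x 0 0 * u 0 0) + bil p x * (y 0 0 * u 0 0) - bil p u * (x 0 0 * y 0 0).

Definition preserves_pw (f : 'rV[R]_4 -> 'rV[R]_4) :=
  forall p X Y, plane_wave (f p) ('d f p X) ('d f p Y) = plane_wave p X Y.

Lemma has_diff_plane_wave (V : normedModType R) (a b c : V -> 'rV[R]_4) p U a' b' c' :
  has_diff a p U a' -> has_diff b p U b' -> has_diff c p U c' ->
  has_diff (fun q => plane_wave (a q) (b q) (c q)) p U
    (plane_wave (a p) b' (c p) + plane_wave (a p) (b p) c' +
     2 * k * bil (a p) a' * (b p 0 0 * c p 0 0)).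
Proof.
move=> ha hb hc; rewrite /plane_wave /bil.
eapply has_diff_eq; first by solve_has_diff.
by rewrite /=; ring.
Qed.

(** The hypotheses are the derivative of metric preservation with its three arguments permuted
    cyclically; p, q, r are the pairings of a second differential with a first one. Half of the
    first plus the second minus the third isolates p. *)
Let lincomb (p q r bu by_ bx Bu By Bx s1 s2 s3 S1 S2 S3 : R) :
  p + r + 2 * k * by_ * s2 = 2 * k * By * S2 ->
  p + q + 2 * k * bx * s3 = 2 * k * Bx * S3 ->
  q + r + 2 * k * bu * s1 = 2 * k * Bu * S1 ->
  p + k * (by_ * s2 + bx * s3 - bu * s1) = k * (By * S2 + Bx * S3 - Bu * S1).
Proof. lra. Qed.

(* Christoffel's cyclic trick. *)
Let second_diff_alg (q p : 'rV[R]_4) (D : 'rV[R]_4 -> 'rV[R]_4)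
    (H : 'rV[R]_4 -> 'rV[R]_4 -> 'rV[R]_4) X Y U :
  (forall A B, H A B = H B A) ->
  (forall A B C, plane_wave q (H A C) (D B) + plane_wave q (D A) (H B C) +
    2 * k * bil q (D C) * (D A 0 0 * D B 0 0) = 2 * k * bil p C * (A 0 0 * B 0 0)) ->
  plane_wave q (H X Y) (D U) + k * christoffel q (D X) (D Y) (D U) =
  k * christoffel p X Y U.
Proof.
move=> sym law; move: (law X U Y) (law Y U X) (law X Y U).
rewrite (sym Y X) (sym U X) (sym U Y) ![plane_wave _ (D _) (H _ _)]plane_wave_sym.
rewrite /christoffel; exact: lincomb.
Qed.

(** Compatibility of f with the Levi-Civita connection, with all indices lowered so that the inverse
    metric never appears. *)
Lemma second_diff_law f p X Y U : smooth f -> preserves_pw f ->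
  plane_wave (f p) ('d (fun q => 'd f q X) p Y) ('d f p U) +
    k * christoffel (f p) ('d f p X) ('d f p Y) ('d f p U) =
  k * christoffel p X Y U.
Proof.
move=> sf pf.
apply: (@second_diff_alg (f p) p (fun Z => 'd f p Z)
  (fun A B => 'd (fun q => 'd f q A) p B)) => [A B|A B C].
  exact: diff_sym_row.
have hA := has_diffP C (smooth_differentiable p (smooth_diff A sf)).
have hB := has_diffP C (smooth_differentiable p (smooth_diff B sf)).
have hf := has_diffP C (smooth_differentiable p sf).
have [_ <-] := has_diff_plane_wave hf hA hB.
rewrite (_ : (fun q => _) = fun q => plane_wave q A B); last first.
  by apply/funext => q; rewrite pf.
have hc Z : has_diff (fun _ : 'rV[R]_4 => Z : 'rV[R]_4) p C 0.
  by split; [exact: differentiable_cst|rewrite (diff_cst Z p)].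
have [_ ->] := has_diff_plane_wave (has_diff_id p C) (hc A) (hc B).
by rewrite /plane_wave /bil !mxE; ring.
Qed.

End PlaneWave.

(** * Rigidity *)

Section Rigidity.
Variables (R : realType) (k j11 j12 j22 : R).
Hypothesis k0 : k != 0.
Hypothesis j0 : j11 * j22 - j12 ^+ 2 != 0.

Local Notation bil := (bil j11 j12 j22).
Local Notation plane_wave := (plane_wave k j11 j12 j22).
Local Notation christoffel := (christoffel j11 j12 j22).
Local Notation et := (vec4 1 0 0 0 : 'rV[R]_4).
Local Notation e1 := (vec4 0 1 0 0 : 'rV[R]_4).
Local Notation e2 := (vec4 0 0 1 0 : 'rV[R]_4).
Local Notation ez := (vec4 0 0 0 1 : 'rV[R]_4).

(** Used on positions as well as on tangent vectors: B(q, U) is the metric pairing of [trans q] with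
    U, which an isometry transports. *)
Definition trans (x : 'rV[R]_4) : 'rV[R]_4 := vec4 0 (x 0 1) (x 0 2) 0.

Definition is_trans (j : 'I_4) := j = 1 \/ j = 2.

Lemma bil_nondegenerate (a b : R) :
  j11 * a + j12 * b = 0 -> j12 * a + j22 * b = 0 -> a = 0 /\ b = 0.
Proof.
move=> h1 h2; split; apply: (mulfI j0); rewrite mulr0.
  by transitivity (j22 * (j11 * a + j12 * b) - j12 * (j12 * a + j22 * b));
    [ring|rewrite h1 h2; ring].
by transitivity (j11 * (j12 * a + j22 * b) - j12 * (j11 * a + j12 * b));
    [ring|rewrite h1 h2; ring].
Qed.

(* [D q X] and [H q X Y] stand for the first and second differentials of [f]
   at [q]; abstracting them avoids expensive unifications of ['d] terms. *)
Section Abstract.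
Variables (f : 'rV[R]_4 -> 'rV[R]_4) (D : 'rV[R]_4 -> 'rV[R]_4 -> 'rV[R]_4)
  (H : 'rV[R]_4 -> 'rV[R]_4 -> 'rV[R]_4 -> 'rV[R]_4).
Hypothesis Dlin : forall q a X Y, D q (a *: X + Y) = a *: D q X + D q Y.
Hypothesis f_line : forall p Y j d,
  (forall s, D (p + s *: Y) Y 0 j = d) -> f (p + Y) 0 j = f p 0 j + d.
Hypothesis D_line : forall X p Y j d,
  (forall s, H (p + s *: Y) X Y 0 j = d) -> D (p + Y) X 0 j = D p X 0 j + d.
Hypothesis H_cst : forall X j c, (forall q, D q X 0 j = c) ->
  forall q Y, H q X Y 0 j = 0.
Hypothesis H_shift : forall X V j, (forall q, D (q + V) X 0 j = D q X 0 j) ->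
  forall q Y, H (q + V) X Y 0 j = H q X Y 0 j.
Hypothesis Hsym : forall q X Y, H q X Y = H q Y X.
Hypothesis law : forall q X Y U,
  plane_wave (f q) (H q X Y) (D q U) + k * christoffel (f q) (D q X) (D q Y) (D q U)
  = k * christoffel q X Y U.
Hypothesis pres : forall q X Y, plane_wave (f q) (D q X) (D q Y) = plane_wave q X Y.
Hypothesis Dsurj : forall q Y, exists X, D q X = Y.
Hypothesis f0 : f 0 = 0.

Let unfoldE := (@vec4E R, @mxE).

Let DE q X : D q X = X 0 0 *: D q et + (X 0 1 *: D q e1 + (X 0 2 *: D q e2 + X 0 3 *: D q ez)).
Proof.
have D0 : D q 0 = 0.
  by have := Dlin q (-1) 0 0; rewrite scaler0 addr0 scaleN1r addNr.
rewrite -[X in _ + (_ + (_ + X))]addr0 -[in RHS]D0 -!Dlin; congr (D q _).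
by rewrite [LHS]vec4_eta [RHS]vec4_eta !unfoldE; congr vec4; ring.
Qed.

(** The preimage U of [ez] enters the law only through U 0 0 and B(q, U). Both are metric pairings
    at q, so they can be evaluated on the image side, against [ez]. *)
Let Dt q X Y : H q X Y 0 0 = k * ((bil q Y * X 0 0 + bil q X * Y 0 0) * D q ez 0 0
  - D q (trans q) 0 0 * (X 0 0 * Y 0 0)).
Proof.
have [U DU] := Dsurj q ez.
have := law q X Y U; rewrite DU.
have -> : plane_wave (f q) (H q X Y) ez = H q X Y 0 0.
  by rewrite /plane_wave /bil !unfoldE; ring.
have -> : christoffel (f q) (D q X) (D q Y) ez = 0.
  by rewrite /christoffel /bil !unfoldE; ring.
rewrite mulr0 addr0 => ->; congr (_ * _).
have U0 : U 0 0 = D q ez 0 0.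
  transitivity (plane_wave q ez U); last rewrite -pres DU;
  by rewrite /plane_wave /bil !unfoldE; ring.
have Uw : bil q U = D q (trans q) 0 0.
  transitivity (plane_wave q (trans q) U); last rewrite -pres DU;
  by rewrite /plane_wave /trans /bil !unfoldE; ring.
by rewrite /christoffel U0 Uw; ring.
Qed.

Let Dez_cst q : D q ez 0 0 = D 0 ez 0 0.
Proof.
rewrite -[q in LHS]add0r -[RHS]addr0; apply: D_line => s.
by rewrite Dt /bil !unfoldE; ring.
Qed.

Let Dw_cst q (X : 'rV[R]_4) : X 0 0 = 0 -> D q X 0 0 = D 0 X 0 0.
Proof.
(* The path from 0 to q runs along the t axis, where B(q, X) = 0, and then inside a slice of
   constant t, where Y 0 0 = 0. Each factor kills the remaining term of [Dt] on its segment. *)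
move=> X0; have E : q = vec4 (q 0 0) 0 0 0 + vec4 0 (q 0 1) (q 0 2) (q 0 3).
  by rewrite [LHS]vec4_eta [RHS]vec4_eta !unfoldE; congr vec4; ring.
rewrite [in LHS]E (D_line (d := 0)) => [|s]; last first.
  by rewrite Dt X0 /bil !unfoldE; ring.
rewrite addr0 -[vec4 _ _ _ _]add0r -[RHS]addr0; apply: D_line => s.
by rewrite Dt X0 /bil !unfoldE; ring.
Qed.

(** By [Dw_cst] the derivative of t o f in a direction X with X 0 0 = 0 is constant, so its
    derivative along [et], which is k B(p, X) c, vanishes for every p. Nondegeneracy of B gives c =
    0. *)
Let Dez0 q : D q ez 0 0 = 0.
Proof.
rewrite Dez_cst; set c := D 0 ez 0 0.
have key p (X : 'rV[R]_4) : X 0 0 = 0 -> bil p X * c = 0.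
  move=> X0; have := H_cst (fun q => Dw_cst q X0) p et.
  rewrite Dt X0 !unfoldE Dez_cst -/c => /eqP; rewrite mulf_eq0 (negPf k0) => /eqP.
  by rewrite mulr0 mulr1 add0r mul0r mulr0 subr0.
have := key e1 e1; have := key e1 e2; have := key e2 e2.
rewrite /bil !unfoldE !(mulr0, mulr1, mul0r, addr0, add0r).
move=> /(_ erefl) h3 /(_ erefl) h2 /(_ erefl) h1.
apply: (mulfI j0); rewrite mulr0 mulrBl -mulrA h3 expr2 -mulrA h2; ring.
Qed.

Let Dt' q X Y : H q X Y 0 0 = - k * (D 0 (trans q) 0 0 * (X 0 0 * Y 0 0)).
Proof. by rewrite Dt Dez0 (@Dw_cst q (trans q)) ?unfoldE//; ring. Qed.

(** Translation argument: by [Dt'] the t component of D q et is unchanged under transverse shifts of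
    q, hence so is its derivative along [et]; but [Dt'] gives that derivative the value - k D 0
    (trans p) 0 0 at [trans p] and 0 at the origin. *)
Let Dtrans0 p : D 0 (trans p) 0 0 = 0.
Proof.
have sh q : D (q + trans p) et 0 0 = D q et 0 0.
  by rewrite -[RHS]addr0; apply: D_line => s; rewrite Dt' !unfoldE; ring.
have := H_shift sh 0 et; rewrite !Dt' add0r.
have -> : trans (trans p) = trans p by rewrite /trans !unfoldE.
have -> : D 0 (trans 0) 0 0 = 0.
  by rewrite DE !unfoldE; ring.
rewrite !unfoldE !mulr1 mulr0 => /eqP; rewrite mulf_eq0 oppr_eq0 (negPf k0).
by move=> /eqP.
Qed.

Let a := D 0 et 0 0.

Let Dta q X : D q X 0 0 = a * X 0 0.
Proof.
rewrite DE !mxE Dez0 !(@Dw_cst q e1, @Dw_cst q e2) ?unfoldE//.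
have -> : e1 = trans e1 by rewrite /trans !unfoldE.
have -> : e2 = trans e2 by rewrite /trans !unfoldE.
rewrite !Dtrans0.
have -> : D q et 0 0 = a.
  rewrite /a -[q in LHS]add0r -[RHS]addr0; apply: D_line => s.
  by rewrite Dt' Dtrans0; ring.
ring.
Qed.

Let fta q : f q 0 0 = a * q 0 0.
Proof.
rewrite -[q in LHS]add0r (f_line (d := a * q 0 0)) => [|s]; last by rewrite Dta.
by rewrite f0 mxE add0r.
Qed.

Let a_neq0 : a != 0.
Proof.
have [U DU] := Dsurj 0 et; have := Dta 0 U; rewrite DU unfoldE => h.
by apply: contra_eq_neq h => ->; rewrite mul0r oner_neq0.
Qed.

(** Pairing [ez] with U gives U 0 0, which is a^-1 times the t component of the image of U. The
    image of [ez] thus has known pairings with all vectors, and nondegeneracy determines it. *)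
Let Dez q : D q ez = vec4 0 0 0 a^-1.
Proof.
have key V : plane_wave (f q) (D q ez) V = a^-1 * V 0 0.
  have [U <-] := Dsurj q V; rewrite pres Dta mulrA mulVf// mul1r.
  by rewrite /plane_wave /bil !unfoldE; ring.
have h0 := Dez0 q.
have h1 := key e1; have h2 := key e2; have h3 := key et.
move: h1 h2 h3; rewrite /plane_wave /bil !unfoldE h0.
rewrite !(mulr0, mulr1, mul0r, mul1r, addr0, add0r) => h1 h2 h3.
have [z1 z2] := bil_nondegenerate h1 h2.
by rewrite [LHS]vec4_eta h0 z1 z2 h3.
Qed.

(** Now the law is tested against a transverse e. Since t o f = a t, the preimage of e has no t
    component, so each Christoffel term reduces to its last summand. *)
Let Dw q X Y j : is_trans j ->
  H q X Y 0 j = k * (a ^+ 2 * f q 0 j - D q (trans q) 0 j) * (X 0 0 * Y 0 0).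
Proof.
have key (e : 'rV[R]_4) : e 0 0 = 0 -> e 0 3 = 0 -> bil (H q X Y) e =
    k * (a ^+ 2 * bil (f q) e - bil (D q (trans q)) e) * (X 0 0 * Y 0 0).
  move=> e0 e3; have [U DU] := Dsurj q e.
  have U0 : U 0 0 = 0 by apply: (mulfI a_neq0); rewrite -(Dta q U) DU e0 mulr0.
  have := law q X Y U; rewrite DU.
  have -> : plane_wave (f q) (H q X Y) e = bil (H q X Y) e.
    by rewrite /plane_wave e0 e3; ring.
  have Uw : bil q U = bil (D q (trans q)) e.
    transitivity (plane_wave q (trans q) U); last rewrite -pres DU;
    by rewrite /plane_wave /trans ?e0 ?e3 ?U0 /bil ?unfoldE; ring.
  rewrite /christoffel U0 e0 !Dta Uw => /(canRL (addrK _)) ->; ring.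
have h1 := key e1; have h2 := key e2.
move: h1 h2; rewrite /bil !unfoldE.
rewrite !(mulr0, mulr1, mul0r, mul1r, addr0, add0r) => /(_ erefl erefl) h1 /(_ erefl erefl) h2.
pose dd j := H q X Y 0 j - k * (a ^+ 2 * f q 0 j - D q (trans q) 0 j) * (X 0 0 * Y 0 0).
have [||z1 z2] := @bil_nondegenerate (dd 1) (dd 2).
- by apply: etrans (etrans (congr1 (fun z => z - _) h1) (subrr _)); rewrite /dd; ring.
- by apply: etrans (etrans (congr1 (fun z => z - _) h2) (subrr _)); rewrite /dd; ring.
by move=> [->|->]; apply/eqP; rewrite -subr_eq0; apply/eqP.
Qed.

Let DwX q (X : 'rV[R]_4) j : is_trans j -> X 0 0 = 0 -> D q X 0 j = D 0 X 0 j.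
Proof.
move=> hj X0; rewrite -[q in LHS]add0r -[RHS]addr0; apply: D_line => s.
by rewrite Dw// X0; ring.
Qed.

Let fw q j : is_trans j ->
  f q 0 j = f (vec4 (q 0 0) 0 0 0) 0 j + D 0 (trans q) 0 j.
Proof.
move=> hj; have E : q = vec4 (q 0 0) 0 0 0 + vec4 0 (q 0 1) (q 0 2) (q 0 3).
  by rewrite [LHS]vec4_eta [RHS]vec4_eta !unfoldE; congr vec4; ring.
rewrite [in LHS]E; apply: f_line => s; rewrite DwX ?unfoldE//.
rewrite DE [in RHS]DE; case: hj => ->; rewrite /trans !unfoldE Dez !unfoldE; ring.
Qed.

Let bilD (X Y : 'rV[R]_4) : X 0 0 = 0 -> Y 0 0 = 0 -> bil (D 0 X) (D 0 Y) = bil X Y.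
Proof.
move=> X0 Y0; have := pres 0 X Y; rewrite /plane_wave !Dta X0 Y0 => h.
by apply: etrans (etrans h _); ring.
Qed.

(** The translation argument again, for w o f: it shows that a^2 - 1 annihilates the transverse part
    of D 0. If a^2 differed from 1 this part would be zero, and B, which it preserves, would
    vanish. *)
Let a2 : a ^+ 2 = 1.
Proof.
have key p j : is_trans j -> (a ^+ 2 - 1) * D 0 (trans p) 0 j = 0.
  move=> hj; have sh q : D (q + trans p) et 0 j = D q et 0 j.
    by rewrite -[RHS]addr0; apply: D_line => s; rewrite Hsym Dw// !unfoldE; ring.
  have tt q : trans (trans q) = trans q by rewrite /trans !unfoldE.
  have := H_shift sh 0 et; rewrite add0r !Dw// (fw (trans p))// tt.
  have -> : vec4 (trans p 0 0) 0 0 0 = 0 :> 'rV[R]_4.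
    by rewrite [RHS]vec4_eta /trans !unfoldE.
  rewrite f0 (DwX (trans p)) ?unfoldE//.
  have -> : D 0 (trans 0) 0 j = 0 by rewrite DE !unfoldE; ring.
  move=> h; apply: (mulfI k0); rewrite mulr0; apply: etrans (etrans h _); ring.
apply/eqP; rewrite -subr_eq0; apply/negP => /negP ne.
have {}key p j : is_trans j -> D 0 (trans p) 0 j = 0.
  by move=> hj; apply: (mulfI ne); rewrite key// mulr0.
have bil0 p q : bil (trans p) (trans q) = 0.
  have k1 r : D 0 (trans r) 0 1 = 0 by apply: key; left.
  have k2 r : D 0 (trans r) 0 2 = 0 by apply: key; right.
  have t0 r : trans r 0 0 = 0 by rewrite unfoldE.
  by rewrite -bilD// /bil !k1 !k2; ring.
have := bil0 e1 e1; have := bil0 e1 e2; rewrite /bil /trans !unfoldE.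
rewrite !(mulr0, mulr1, mul0r, addr0, add0r) => h2 h1.
by move/eqP: j0; rewrite h1 h2; apply; ring.
Qed.

Lemma abstract_rigidity : [/\ a ^+ 2 = 1,
  forall q X, D q X 0 0 = a * X 0 0, forall q, f q 0 0 = a * q 0 0,
  forall X Y : 'rV[R]_4, X 0 0 = 0 -> Y 0 0 = 0 -> bil (D 0 X) (D 0 Y) = bil X Y &
  forall j, is_trans j ->
    (forall q, f q 0 j = f (vec4 (q 0 0) 0 0 0) 0 j + D 0 (trans q) 0 j) /\
    (forall s, H (s *: et) et et 0 j = k * f (s *: et) 0 j)].
Proof.
split => // j hj; split => [q|s]; first exact: fw.
rewrite Dw// a2 DwX ?unfoldE// DE !unfoldE; ring.
Qed.

End Abstract.
End Rigidity.

(** * Explicit isometries *)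

Lemma mx2E (R : pzSemiRingType) m n (A : 'M[R]_(m, 2)) (B : 'M[R]_(2, n)) i j :
  (A *m B) i j = A i 0 * B 0 j + A i 1 * B 1 j.
Proof.
rewrite mxE !big_ord_recl big_ord0 addr0.
by rewrite (_ : lift ord0 ord0 = 1)//; exact: val_inj.
Qed.

Lemma det2 (R : comPzRingType) (M : 'M[R]_2) :
  \det M = M 0 0 * M 1 1 - M 0 1 * M 1 0.
Proof.
rewrite (expand_det_row M 0) !big_ord_recl big_ord0 addr0 /cofactor !det_mx11 !mxE.
rewrite (_ : lift ord0 ord0 = 1); last exact: val_inj.
rewrite (_ : lift 1 0 = 0); last exact: val_inj.
by rewrite expr0 expr1 mul1r mulN1r mulrN.
Qed.

Section Isometries.
Variables (R : realType) (k j11 j12 j22 : R) (S C : R -> R) (s0 : R).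
Hypothesis j0 : j11 * j22 - j12 ^+ 2 != 0.
Hypothesis dS : forall x : R, is_derive x 1 S (C x).
Hypothesis dC : forall x : R, is_derive x 1 C (k * S x).
Hypothesis S0 : S 0 = 0.
Hypothesis C0 : C 0 = 1.
Hypothesis Ss0 : S s0 != 0.

Local Notation bil := (bil j11 j12 j22).
Local Notation plane_wave := (plane_wave k j11 j12 j22).
Local Notation preserves_pw := (preserves_pw k j11 j12 j22).
Local Notation et := (vec4 1 0 0 0 : 'rV[R]_4).
Local Notation e1 := (vec4 0 1 0 0 : 'rV[R]_4).
Local Notation e2 := (vec4 0 0 1 0 : 'rV[R]_4).

Let unfoldE := (@vec4E R, @mxE).

(** Conserved energy of S'' = k S, the common form of cos^2 + sin^2 = 1 and cosh^2 - sinh^2 = 1. *)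
Lemma CS1 x : C x ^+ 2 - k * S x ^+ 2 = 1.
Proof.
have := @is_derive_0_is_cst R (fun x => C x * C x - k * (S x * S x)) x 0.
rewrite S0 C0 !expr2 !mulr0 subr0 mulr1; apply => {}x.
have -> : 0 = (C x *: (k * S x) + C x *: (k * S x)) - k *: (S x *: C x + S x *: C x).
  by rewrite /GRing.scale /=; ring.
apply: is_deriveB.
Qed.

(* The Wronskians of [y] with [S] and [C] are constant. *)
Lemma ode_unique (y y' : R -> R) : (forall x : R, is_derive x 1 y (y' x)) ->
  (forall x : R, is_derive x 1 y' (k * y x)) -> y 0 = 0 ->
  forall x, y x = S x * y' 0.
Proof.
move=> dy dy' y0 x.
have W1 : C x * y x - S x * y' x = 0.
  have := @is_derive_0_is_cst R (fun x => C x * y x - S x * y' x) x 0.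
  rewrite S0 y0 mulr0 mul0r subr0; apply => {}x.
  by apply: is_derive_eq; rewrite /GRing.scale /=; ring.
have W2 : C x * y' x - k * (S x * y x) = y' 0.
  have := @is_derive_0_is_cst R (fun x => C x * y' x - k * (S x * y x)) x 0.
  rewrite S0 y0 C0 mul0r mulr0 subr0 mul1r; apply => z.
  by apply: is_derive_eq; rewrite /GRing.scale /=; ring.
rewrite -W2; transitivity ((C x ^+ 2 - k * S x ^+ 2) * y x); first by rewrite CS1 mul1r.
by apply/eqP; rewrite -subr_eq0; apply/eqP; rewrite -[RHS](mulr0 (C x)) -W1; ring.
Qed.

(** Oddness of S: x |-> S(a x) solves the same equation with slope a at 0, so [ode_unique]
    applies. *)
Lemma S_sign a x : a ^+ 2 = 1 -> S (a * x) = a * S x.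
Proof.
move=> a2.
have da (y : R) : is_derive y 1 (fun y => a * y) a.
  apply: is_derive_has_diff; apply: has_diff_eq.
    exact: (has_diffM (has_diff_cst y 1 a) (has_diff_id y (1 : R))).
  by rewrite /=; ring.
have dSa (y : R) : is_derive y 1 (S \o (fun y => a * y)) (a * C (a * y)).
  by rewrite [_ * C _]mulrC; exact: is_derive1_comp.
have dCa (y : R) : is_derive y 1 (fun y => a * C (a * y)) (k * S (a * y)).
  have dCa : is_derive y 1 (C \o (fun y => a * y)) (k * S (a * y) * a).
    exact: is_derive1_comp.
  by apply: is_derive_eq; rewrite /GRing.scale /=; ring: a2.
have := ode_unique dSa dCa; rewrite /= mulr0 S0 C0 mulr1 => /(_ erefl) ->.
exact: mulrC.
Qed.

(** Obtained by differentiating [S_sign] and cancelling a. *)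
Lemma C_sign a x : a ^+ 2 = 1 -> C (a * x) = C x.
Proof.
move=> a2; have dSa' : is_derive x 1 (fun y => a * S y) (a * C x).
  by apply: is_derive_eq; rewrite /GRing.scale /=; ring.
have dSa : is_derive x 1 (fun y => a * S y) (C (a * x) * a).
  have da : is_derive x 1 (fun y => a * y) a.
    apply: is_derive_has_diff; apply: has_diff_eq.
      exact: (has_diffM (has_diff_cst x 1 a) (has_diff_id x (1 : R))).
    by rewrite /=; ring.
  have -> : (fun y => a * S y) = S \o (fun y => a * y).
    by apply/funext => y /=; rewrite S_sign.
  exact: is_derive1_comp.
have := @derive_val _ _ _ _ _ _ _ dSa'; rewrite (@derive_val _ _ _ _ _ _ _ dSa).
by move=> h; transitivity (a * (C (a * x) * a)); [|rewrite h]; ring: a2.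
Qed.

Lemma Ck_SC (V : normedModType R) n (f : V -> R) :
  Ck n f -> Ck n (fun x => S (f x)) /\ Ck n (fun x => C (f x)).
Proof.
have cont (h h' : R -> R) : (forall x : R, is_derive x 1 h (h' x)) -> continuous h.
  move=> dh x; apply: differentiable_continuous; apply/derivable1_diffP.
  exact: (@ex_derive _ _ _ _ _ _ _ (dh x)).
elim: n => [|n IH] Cf.
  split=> x; (apply: continuous_comp; first exact: Cf).
    exact: (cont _ _ dS).
  exact: (cont _ _ dC).
have [df Cdf] := Cf; have [CS CC] := IH (CkS Cf).
have ds x v := @diff_comp1 _ _ S _ f x v (df x) (dS (f x)).
have dc x v := @diff_comp1 _ _ C _ f x v (df x) (dC (f x)).
split; split=> [x|v].
- exact: (ds x 0).1.
- by under eq_fun do rewrite (ds _ v).2; apply: CkM => //; exact: Cdf.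
- exact: (dc x 0).1.
- under eq_fun do rewrite (dc _ v).2; apply: CkM; last exact: Cdf.
  by apply: CkM => //; exact: Ck_cst.
Qed.

Definition lin (a : R) (M : 'M[R]_2) (x : 'rV[R]_4) : 'rV[R]_4 :=
  vec4 (a * x 0 0) (M 0 0 * x 0 1 + M 0 1 * x 0 2) (M 1 0 * x 0 1 + M 1 1 * x 0 2)
    (a * x 0 3).

Definition emb (b : 'cV[R]_2) : 'rV[R]_4 := vec4 0 (b 0 0) (b 1 0) 0.

(** Time-one flow of the Killing field S(t) b d/dw - C(t) B(w, b) d/dz. The profile S vanishes at t
    = 0, so the origin is fixed. *)
Definition shear (b x : 'rV[R]_4) : 'rV[R]_4 :=
  vec4 (x 0 0) (x 0 1 + S (x 0 0) * b 0 1) (x 0 2 + S (x 0 0) * b 0 2)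
    (x 0 3 - C (x 0 0) * bil x b - 2^-1 * bil b b * (S (x 0 0) * C (x 0 0))).

Definition pw_iso (g : R * 'M[R]_2 * 'cV[R]_2) (x : 'rV[R]_4) : 'rV[R]_4 :=
  shear (emb g.2) (lin g.1.1 g.1.2 x).

(** The orthogonal group of B, stated on R^4 because [bil] reads only the two middle coordinates. *)
Definition OJ : set 'M[R]_2 :=
  [set M | forall x y, bil (lin 1 M x) (lin 1 M y) = bil x y].

(** Recovers (a, M, b) from four values of f. At [e1] and [e2], where t = 0 and S vanishes, the
    images are the columns of M. At s0 et the transverse part of the image is S(a s0) b = a S(s0) b,
    and a is its own inverse. *)
Definition pw_param (f : 'rV[R]_4 -> 'rV[R]_4) : R * 'M[R]_2 * 'cV[R]_2 :=
  (f et 0 0,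
   \matrix_(i, j) f (if j == 0 then e1 else e2) 0 (if i == 0 then 1 else 2),
   \col_i ((S s0)^-1 * f et 0 0 * f (s0 *: et) 0 (if i == 0 then 1 else 2))).

Let OJE M : OJ M -> [/\
  j11 * M 0 0 ^+ 2 + j12 * (2 * M 0 0 * M 1 0) + j22 * M 1 0 ^+ 2 = j11,
  j11 * (M 0 0 * M 0 1) + j12 * (M 0 0 * M 1 1 + M 1 0 * M 0 1) + j22 * (M 1 0 * M 1 1) = j12 &
  j11 * M 0 1 ^+ 2 + j12 * (2 * M 0 1 * M 1 1) + j22 * M 1 1 ^+ 2 = j22].
Proof.
move=> OM; have := OM e1 e1; have := OM e1 e2; have := OM e2 e2.
rewrite /bil /lin !unfoldE !(mulr0, mulr1, mul0r, mul1r, addr0, add0r) => h3 h2 h1.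
by split; [rewrite -[RHS]h1|rewrite -[RHS]h2|rewrite -[RHS]h3]; ring.
Qed.

(** With J the Gram matrix of B, determinants in M^T J M = J give (det M)^2 det J = det J, and det J
    is nonzero. *)
Lemma OJ_unit M : OJ M -> M \in unitmx.
Proof.
move=> /OJE [h1 h2 h3].
pose d := M 0 0 * M 1 1 - M 0 1 * M 1 0.
have : d ^+ 2 * (j11 * j22 - j12 ^+ 2) = j11 * j22 - j12 ^+ 2.
  by rewrite -[X in _ = X * _ - _ ^+ 2]h1 -[X in _ = _ * X - _ ^+ 2]h3 -[X in _ = _ - X ^+ 2]h2 /d; ring.
rewrite unitmxE unitfE det2 -/d; apply: contra_eq_neq => ->.
by rewrite expr2 !mul0r eq_sym.
Qed.

Lemma lin_mul a a' M M' x : lin (a * a') (M *m M') x = lin a M (lin a' M' x).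
Proof. by rewrite /lin !vec4E; congr vec4; rewrite ?mx2E; ring. Qed.

Lemma diff_vec4_eq (V : normedModType R) (f1 f2 f3 f4 : V -> R) x v a b c d w :
  has_diff f1 x v a -> has_diff f2 x v b -> has_diff f3 x v c -> has_diff f4 x v d ->
  vec4 a b c d = w -> 'd (fun x => vec4 (f1 x) (f2 x) (f3 x) (f4 x)) x v = w.
Proof. by move=> h1 h2 h3 h4 <-; exact: diff_vec4. Qed.

Lemma has_diff_S (V : normedModType R) (f : V -> R) x v a :
  has_diff f x v a -> has_diff (fun x => S (f x)) x v (C (f x) * a).
Proof. by move=> [df <-]; exact: (diff_comp1 v df (dS _)). Qed.

Lemma has_diff_C (V : normedModType R) (f : V -> R) x v a :
  has_diff f x v a -> has_diff (fun x => C (f x)) x v (k * S (f x) * a).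
Proof. by move=> [df <-]; exact: (diff_comp1 v df (dC _)). Qed.

Lemma smooth_lin a M : smooth (lin a M).
Proof.
by apply: smooth_vec4 => n; repeat first
  [ exact: Ck_coord | exact: Ck_cst | apply: CkD | apply: CkM ].
Qed.

Lemma smooth_shear b : smooth (shear b).
Proof.
by apply: smooth_vec4 => n; repeat first
  [ exact: Ck_coord | exact: Ck_cst | apply: (Ck_SC _).1 | apply: (Ck_SC _).2
  | apply: CkD | apply: CkM | apply: CkN ].
Qed.

Lemma smooth_pw_iso g : smooth (pw_iso g).
Proof. exact: smooth_comp (smooth_lin _ _) (smooth_shear _). Qed.

Lemma preserves_pw_shear b : preserves_pw (shear b).
Proof.
move=> p X Y.
have dsh Z : 'd (shear b) p Z = vec4 (Z 0 0) (Z 0 1 + C (p 0 0) * Z 0 0 * b 0 1)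
   (Z 0 2 + C (p 0 0) * Z 0 0 * b 0 2)
   (Z 0 3 - C (p 0 0) * bil Z b - k * S (p 0 0) * Z 0 0 * bil p b
     - 2^-1 * bil b b * Z 0 0 * (C (p 0 0) ^+ 2 + k * S (p 0 0) ^+ 2)).
  rewrite /shear /bil; eapply diff_vec4_eq; try by
    repeat first [eapply has_diff_S | eapply has_diff_C | progress solve_has_diff].
  by rewrite /=; congr vec4; ring.
rewrite !dsh /plane_wave /shear /bil !vec4E.
(* [CS1] is put in the form C^2 = 1 + k S^2, with a monomial on the left, so that [field] can
   rewrite with it. *)
have /(congr1 (fun z => z + k * S (p 0 0) ^+ 2)) := CS1 (p 0 0); rewrite subrK.
by move: (C _) (S _) => c s h; field: h.
Qed.

Lemma preserves_pw_lin a M : a ^+ 2 = 1 -> OJ M -> preserves_pw (lin a M).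
Proof.
move=> a2 OM p X Y.
have dl Z : 'd (lin a M) p Z = lin a M Z.
  eapply diff_vec4_eq; [solve_has_diff..|by rewrite /lin /=; congr vec4; ring].
have bl x y : bil (lin a M x) (lin a M y) = bil x y.
  by rewrite -[RHS](OM x y) /bil /lin !vec4E.
by rewrite !dl /plane_wave !bl /lin !vec4E; ring: a2.
Qed.

Lemma preserves_pw_comp f h : smooth f -> smooth h ->
  preserves_pw f -> preserves_pw h -> preserves_pw (fun x => h (f x)).
Proof.
move=> sf sh pf ph p X Y.
have E Z := diff_compE Z (smooth_differentiable p sf) (smooth_differentiable (f p) sh).
exact: (etrans (congr2 (plane_wave (h (f p))) (E X) (E Y)) (etrans (ph _ _ _) (pf p X Y))).
Qed.

Lemma preserves_pw_iso g : semidirect OJ g -> preserves_pw (pw_iso g).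
Proof.
move=> [g1 gO]; apply: preserves_pw_comp; first exact: smooth_lin.
- exact: smooth_shear.
- by apply: preserves_pw_lin => //; case: g1 => ->; rewrite ?sqrrN expr1n.
- exact: preserves_pw_shear.
Qed.

End Isometries.

(** * Composition law and uniqueness of the explicit isometries *)

Section Classification.
Variables (R : realType) (k j11 j12 j22 : R) (S C : R -> R) (s0 : R).
Hypothesis j0 : j11 * j22 - j12 ^+ 2 != 0.
Hypothesis dS : forall x : R, is_derive x 1 S (C x).
Hypothesis dC : forall x : R, is_derive x 1 C (k * S x).
Hypothesis S0 : S 0 = 0.
Hypothesis C0 : C 0 = 1.
Hypothesis Ss0 : S s0 != 0.

Local Notation bil := (bil j11 j12 j22).
Local Notation plane_wave := (plane_wave k j11 j12 j22).
Local Notation preserves_pw := (preserves_pw k j11 j12 j22).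
Local Notation et := (vec4 1 0 0 0 : 'rV[R]_4).

Local Notation shear := (shear j11 j12 j22 S C).
Local Notation pw_iso := (pw_iso j11 j12 j22 S C).
Local Notation OJ := (OJ j11 j12 j22).
Local Notation pw_param := (pw_param S s0).

Let Ss := S_sign dS dC S0 C0.
Let Cs := C_sign dS dC S0 C0.

Let scE (a : R) m n (A : 'M[R]_(m, n)) i j : (a *: A) i j = a * A i j.
Proof. by rewrite mxE. Qed.

(** Origin of the action w |-> a M w in the semidirect product: M acts on b, and the time change t
    |-> a t contributes the sign a because S is odd. *)
Lemma lin_shear a M b x : a ^+ 2 = 1 -> OJ M ->
  lin a M (shear (emb b) x) = shear (emb (a *: (M *m b))) (lin a M x).
Proof.
move=> a2 OM.
have h u v : bil (lin a M u) (emb (a *: (M *m v))) = a * bil u (emb v).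
  by rewrite -(OM u (emb v)) /bil /lin /emb !vec4E !scE !mx2E; ring.
have q v : bil (emb (a *: (M *m v))) (emb (a *: (M *m v))) = bil (emb v) (emb v).
  rewrite -(OM (emb v) (emb v)) -[RHS]mul1r -a2.
  by rewrite /bil /lin /emb !vec4E !scE !mx2E; ring.
rewrite /shear h q [in LHS]/lin !vec4E (Ss _ a2) (Cs _ a2).
rewrite /lin /emb ?vec4E !scE !mx2E !(mulrACA a (S _) a) -expr2 a2 !mul1r.
by congr vec4; ring.
Qed.

(** The bracket of two Killing fields of this kind is given by the Wronskian of their profiles,
    which vanishes for multiples of the same S. The shears therefore form the abelian factor R^2. *)
Lemma shear_add b b' x : shear (emb b) (shear (emb b') x) = shear (emb (b + b')) x.
Proof. by rewrite /shear /emb /bil !vec4E !mxE; congr vec4; field. Qed.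

Let sgn_sq (a : R) : a = 1 \/ a = -1 -> a ^+ 2 = 1.
Proof. by case=> ->; rewrite ?sqrrN expr1n. Qed.

Lemma pw_iso_mul g h x : semidirect OJ g ->
  pw_iso (semidirect_mul g h) x = pw_iso g (pw_iso h x).
Proof.
case: g h => [[a M] b] [[a' M'] b'] [/= /sgn_sq a2 OM].
by rewrite /pw_iso /semidirect_mul /= lin_mul (lin_shear _ _ a2 OM) shear_add.
Qed.

Lemma OJ1 : OJ 1%:M.
Proof. by move=> x y; rewrite /bil /lin !vec4E !mxE /=; ring. Qed.

Lemma OJM M N : OJ M -> OJ N -> OJ (M *m N).
Proof. by move=> OM ON x y; rewrite -[1]mul1r !lin_mul OM ON. Qed.

Lemma pw_iso1 : pw_iso (1, 1%:M, 0) =1 id.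
Proof.
move=> x; rewrite /pw_iso /shear /lin /emb /bil !vec4E !mxE /= [RHS]vec4_eta.
by congr vec4; ring.
Qed.

Lemma OJV M : OJ M -> OJ (invmx M).
Proof.
move=> OM x y; rewrite -OM -!lin_mul mulr1 mulmxV ?OJ1//.
exact: OJ_unit OM.
Qed.

Lemma semidirect_mulV g : semidirect OJ g -> exists h, [/\ semidirect OJ h,
  semidirect_mul g h = (1, 1%:M, 0) & semidirect_mul h g = (1, 1%:M, 0)].
Proof.
case: g => [[a M] b] [/= ha OM]; have a2 := sgn_sq ha.
exists (a, invmx M, - (a *: (invmx M *m b))).
have uM : M \in unitmx by exact: OJ_unit OM.
rewrite /semidirect_mul /=; split; first by split => //=; exact: OJV.
- rewrite -expr2 a2 mulmxV// mulmxN -scalemxAr scalerN scalerA -expr2 a2 scale1r.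
  by rewrite mulmxA mulmxV// mul1mx subrr.
- by rewrite -expr2 a2 mulVmx// addNr.
Qed.

Lemma pw_iso0 g : pw_iso g 0 = 0.
Proof.
rewrite /pw_iso /shear /lin /bil !vec4E !mxE !mulr0 addr0 S0 [RHS]vec4_eta !mxE.
by congr vec4; ring.
Qed.

Lemma pw_paramK g : semidirect OJ g -> pw_param (pw_iso g) = g.
Proof.
case: g => [[a M] b] [/= ha OM]; have a2 := sgn_sq ha.
congr (_, _, _); first by rewrite /pw_iso /shear /lin !vec4E mulr1.
  apply/matrixP => -[[|[|//]] hi] [[|[|//]] hj]; rewrite mxE /=;
  rewrite /pw_iso /shear /lin /= !vec4E !mulr0 S0 ?(mulr0, mulr1, mul0r, addr0, add0r);
  by congr (M _ _); exact: val_inj.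
have cancel c : (S s0)^-1 * a * (0 + 0 + a * S s0 * c) = c.
  rewrite !add0r -[RHS]mul1r -a2 -[in RHS](mulfK Ss0 (a ^+ 2)); ring.
apply/colP => -[[|[|//]] hi]; rewrite mxE /= /pw_iso /shear /lin /emb /= !vec4E
  !scE !vec4E !mulr0 !mulr1 (Ss _ a2) cancel; congr (b _ _); exact: val_inj.
Qed.

Let is_trans1 : is_trans 1. Proof. by left. Qed.
Let is_trans2 : is_trans 2. Proof. by right. Qed.

(** The product of y with itself is affine in y 0 3, and the product of x with y is affine in x 0 3
    once y 0 3 is known. The slopes are multiples of y 0 0, so both equations can be solved. *)
Lemma third_coord_eq (p p' x x' y y' : 'rV[R]_4) :
  (forall j, is_trans j -> p 0 j = p' 0 j) ->
  x 0 0 = x' 0 0 -> (forall j, is_trans j -> x 0 j = x' 0 j) ->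
  y 0 0 = y' 0 0 -> (forall j, is_trans j -> y 0 j = y' 0 j) -> y 0 0 != 0 ->
  plane_wave p y y = plane_wave p' y' y' -> plane_wave p x y = plane_wave p' x' y' ->
  x 0 3 = x' 0 3.
Proof.
move=> hp hx0 hx hy0 hy y0.
rewrite /plane_wave /bil hx0 hy0 !(hx _ is_trans1) !(hx _ is_trans2) !(hy _ is_trans1).
rewrite !(hy _ is_trans2) !(hp _ is_trans1) !(hp _ is_trans2); rewrite hy0 in y0.
move=> h1; have hy3 : y 0 3 = y' 0 3.
  apply: (mulfI y0); lra.
rewrite hy3 => h2; apply: (mulfI y0); lra.
Qed.

Lemma diff_coordE n m (f : 'rV[R]_n -> 'rV[R]_m) q X j : smooth f ->
  'd (fun x => f x 0 j : R) q X = 'd f q X 0 j.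
Proof.
by move=> sf; have [] := has_diff_coord_comp j (has_diffP X (smooth_differentiable q sf)).
Qed.

Lemma smooth_coord n m (f : 'rV[R]_n -> 'rV[R]_m) j :
  smooth f -> smooth (fun x => f x 0 j : R).
Proof. by move=> sf d; exact: Ck_coord_comp. Qed.

(** [third_coord_eq], with y the image of [et], gives the z coordinates equal differentials, and
    they agree at 0. *)
Lemma pw_unique (a : R) f h : a != 0 -> smooth f -> smooth h ->
  preserves_pw f -> preserves_pw h -> f 0 = h 0 ->
  (forall q, f q 0 0 = a * q 0 0) -> (forall q, f q 0 0 = h q 0 0) ->
  (forall j q, is_trans j -> f q 0 j = h q 0 j) -> f = h.
Proof.
move=> a0 sf sh pf ph fh0 fa fh fht.
have dE q X j : (forall x, f x 0 j = h x 0 j) -> 'd f q X 0 j = 'd h q X 0 j.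
  move=> E; apply: etrans (esym (diff_coordE q X j sf)) _.
  exact: etrans (congr1 (fun F : 'rV[R]_4 -> R => 'd F q X) (funext E)) (diff_coordE q X j sh).
have da q X : 'd f q X 0 0 = a * X 0 0.
  apply: etrans (esym (diff_coordE q X 0 sf)) _.
  apply: etrans (congr1 (fun F : 'rV[R]_4 -> R => 'd F q X) (funext fa)) _.
  have [_ ->] := has_diffM (has_diff_cst q X a) (has_diff_coord q X 0).
  by rewrite mulr0 addr0.
have d3 q X : 'd f q X 0 3 = 'd h q X 0 3.
  apply: (@third_coord_eq (f q) (h q) _ _ ('d f q et) ('d h q et)).
  - by move=> j hj; exact: fht.
  - exact: dE.
  - by move=> j hj; apply: dE => x; exact: fht.
  - exact: dE.
  - by move=> j hj; apply: dE => x; exact: fht.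
  - by rewrite da vec4E mulr1.
  - exact: etrans (pf _ _ _) (esym (ph _ _ _)).
  - exact: etrans (pf _ _ _) (esym (ph _ _ _)).
have f3 q : f q 0 3 = h q 0 3.
  pose F x : R := f x 0 3 - h x 0 3.
  have dF x X : has_diff F x X 0.
    rewrite -[X in has_diff _ _ _ X](subrr ('d f x X 0 3)) [X in _ - X]d3.
    apply: has_diffD; first exact/has_diff_coord_comp/has_diffP/smooth_differentiable.
    apply: has_diffN.
    exact/has_diff_coord_comp/has_diffP/smooth_differentiable.
  have := @line_cst _ _ F 0 q 0 (fun x => (dF x 0).1) (fun s => (dF _ _).2).
  by rewrite add0r addr0 /F fh0 subrr => /eqP; rewrite subr_eq0 => /eqP.
apply/funext => q; rewrite [LHS]vec4_eta [RHS]vec4_eta.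
by rewrite fh f3 !(fht _ _ is_trans1) !(fht _ _ is_trans2).
Qed.

End Classification.

Section SmoothRows.
Variables (R : realType) (n m : nat) (f : 'rV[R]_n -> 'rV[R]_m).
Hypothesis sf : smooth f.

Lemma row_line p Y j (d : R) : (forall s : R, 'd f (p + s *: Y) Y 0 j = d) ->
  f (p + Y) 0 j = f p 0 j + d.
Proof.
move=> h; apply: (@line_cst _ _ (fun x => f x 0 j)) => [x|s].
  exact/smooth_differentiable/smooth_coord.
exact: etrans (diff_coordE _ _ _ sf) (h s).
Qed.

Lemma row_diff_cst j (c : R) q Y : (forall x, f x 0 j = c) -> 'd f q Y 0 j = 0.
Proof.
move=> fc; apply: etrans (esym (diff_coordE q Y j sf)) _.
apply: etrans (congr1 (fun F : 'rV[R]_n -> R => 'd F q Y) (funext fc)) _.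
exact: (has_diff_cst q Y c).2.
Qed.

Lemma row_diff_shift j V q Y : (forall x, f (x + V) 0 j = f x 0 j) ->
  'd f (q + V) Y 0 j = 'd f q Y 0 j.
Proof.
move=> fV; apply: etrans (esym (diff_coordE _ Y j sf)) _.
have df x := smooth_differentiable x (smooth_coord j sf).
have [_ E] := has_diff_comp (has_diff_shift V q Y) (df _).
apply: etrans (esym E) _.
apply: etrans (congr1 (fun F : 'rV[R]_n -> R => 'd F q Y) (funext fV)) _.
exact: diff_coordE.
Qed.

Lemma is_derive_row j Y (s : R) :
  is_derive s 1 (fun r : R => f (r *: Y) 0 j) ('d f (s *: Y) Y 0 j).
Proof.
have := @is_derive_line R _ (fun x => f x 0 j) 0 Y s
  (smooth_differentiable _ (smooth_coord j sf)).
rewrite (_ : (fun r : R => _) = (fun r : R => f (r *: Y) 0 j)); last first.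
  by apply/funext => r; rewrite add0r.
by rewrite add0r (diff_coordE _ _ _ sf).
Qed.

End SmoothRows.

(** * Every isometry of the plane wave fixing the origin is explicit *)

Section Rigid.
Variables (R : realType) (k j11 j12 j22 : R) (S C : R -> R) (s0 : R).
Hypothesis k0 : k != 0.
Hypothesis j0 : j11 * j22 - j12 ^+ 2 != 0.
Hypothesis dS : forall x : R, is_derive x 1 S (C x).
Hypothesis dC : forall x : R, is_derive x 1 C (k * S x).
Hypothesis S0 : S 0 = 0.
Hypothesis C0 : C 0 = 1.
Hypothesis Ss0 : S s0 != 0.

Local Notation bil := (bil j11 j12 j22).
Local Notation preserves_pw := (preserves_pw k j11 j12 j22).
Local Notation et := (vec4 1 0 0 0 : 'rV[R]_4).
Local Notation e1 := (vec4 0 1 0 0 : 'rV[R]_4).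
Local Notation e2 := (vec4 0 0 1 0 : 'rV[R]_4).

Local Notation shear := (shear j11 j12 j22 S C).
Local Notation pw_iso := (pw_iso j11 j12 j22 S C).
Local Notation OJ := (OJ j11 j12 j22).
Local Notation pw_param := (pw_param S s0).

Let unfoldE := (@vec4E R, @mxE).

Let is_trans1 : is_trans 1. Proof. by left. Qed.
Let is_trans2 : is_trans 2. Proof. by right. Qed.

(** [abstract_rigidity] and [ode_unique] give t o f and w o f in closed form, from which the
    parameters are read. The explicit isometry with these parameters has the same t and w
    coordinates, so [pw_unique] concludes. *)
Lemma pw_classify f f' : smooth f -> smooth f' -> cancel f f' -> cancel f' f ->
  preserves_pw f -> f 0 = 0 ->
  semidirect OJ (pw_param f) /\ pw_iso (pw_param f) = f.
Proof.
move=> sf sf' fK f'K pf f0.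
have sD X : smooth (fun q => 'd f q X) by exact: smooth_diff.
have surj q Y : exists X, 'd f q X = Y.
  exists ('d f' (f q) Y); rewrite -[q in 'd f q _]fK.
  by apply: diffK => //; exact: smooth_differentiable.
have [||||||||||a2 Dt ft bilD wE] := @abstract_rigidity R k j11 j12 j22 k0 j0 f
  (fun q X => 'd f q X) (fun q X Y => 'd (fun x => 'd f x X) q Y).
- by move=> q a X Y; exact: linearP.
- exact: row_line sf.
- by move=> X; exact: row_line (sD X).
- by move=> X j c h q Y; exact: (row_diff_cst (sD X) q Y h).
- by move=> X V j h q Y; exact: (row_diff_shift (sD X) q Y h).
- by move=> q X Y; exact: diff_sym_row.
- by move=> q X Y U; exact: second_diff_law.
- exact: pf.
- exact: surj.
- exact: f0.
set a := 'd f 0 et 0 0 in a2 Dt ft.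
pose c j := 'd f 0 et 0 j; pose m Z j := 'd f 0 Z 0 j.
have mlin q j : m (trans q) j = q 0 1 * m e1 j + q 0 2 * m e2 j.
  rewrite (_ : trans q = q 0 1 *: e1 + q 0 2 *: e2); last first.
    by rewrite [RHS]vec4_eta /trans !unfoldE; congr vec4; ring.
  by rewrite /m linearP linearZ !mxE.
have fj j : is_trans j ->
    forall q, f q 0 j = S (q 0 0) * c j + (q 0 1 * m e1 j + q 0 2 * m e2 j).
  move=> hj q; have [fw Hode] := wE j hj.
  have ode := ode_unique dS dC S0 C0 (is_derive_row sf j et)
    (fun s => is_derive_eq (is_derive_row (sD et) j et s) (Hode s)).
  rewrite fw; congr (_ + _); last exact: mlin.
  have -> : vec4 (q 0 0) 0 0 0 = q 0 0 *: et.
    by rewrite [RHS]vec4_eta !unfoldE; congr vec4; ring.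
  by rewrite ode ?scale0r// f0 mxE.
have {}bilD (X Y : 'rV[R]_4) : bil (vec4 0 (X 0 1 * m e1 1 + X 0 2 * m e2 1)
      (X 0 1 * m e1 2 + X 0 2 * m e2 2) 0)
    (vec4 0 (Y 0 1 * m e1 1 + Y 0 2 * m e2 1)
      (Y 0 1 * m e1 2 + Y 0 2 * m e2 2) 0) = bil X Y.
  have t0 q : trans q 0 0 = 0 :> R by rewrite /trans vec4E.
  apply: etrans (etrans (bilD _ _ (t0 X) (t0 Y)) _).
    by rewrite /bil !vec4E -!mlin.
  by rewrite /bil /trans !vec4E.
clearbody c m a; clear wE.
have fe1 j : is_trans j -> f e1 0 j = m e1 j.
  by move=> hj; rewrite fj// !vec4E S0; ring.
have fe2 j : is_trans j -> f e2 0 j = m e2 j.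
  by move=> hj; rewrite fj// !vec4E S0; ring.
have fs0 j : is_trans j -> f (s0 *: et) 0 j = S s0 * c j.
  move=> hj; rewrite (_ : s0 *: et = vec4 s0 0 0 0); last first.
    by rewrite [LHS]vec4_eta !mxE /=; congr vec4; ring.
  by rewrite fj// !vec4E; ring.
have fet : f et 0 0 = a by rewrite ft vec4E mulr1.
have par : semidirect OJ (pw_param f).
  split; rewrite /pw_param /=.
    rewrite fet; have /eqP := a2; rewrite sqrf_eq1 => /orP[/eqP|/eqP]; [by left|by right].
  move=> X Y; rewrite -[RHS]bilD /lin /bil !vec4E !mxE /=.
  by rewrite !(fe1 _ is_trans1) !(fe1 _ is_trans2) !(fe2 _ is_trans1) !(fe2 _ is_trans2); ring.
split; first exact: par.
apply: (@pw_unique _ k j11 j12 j22 a).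
- by apply: contra_eq_neq a2 => ->; rewrite expr2 mul0r eq_sym oner_neq0.
- exact: (smooth_pw_iso _ _ _ dS dC).
- exact: sf.
- exact: (preserves_pw_iso dS dC S0 C0 par).
- exact: pf.
- by rewrite f0; exact: pw_iso0.
- by move=> q; rewrite /pw_iso /shear /lin !vec4E /= fet.
- by move=> q; rewrite /pw_iso /shear /lin !vec4E /= fet ft.
move=> j q hj; rewrite fj//.
have cancel c' : (S s0)^-1 * a * (S s0 * c') = a * c'.
  by rewrite [_^-1 * a]mulrC -mulrA mulKf.
have Sa t := S_sign dS dC S0 C0 t a2.
rewrite /pw_iso /shear /lin /emb /=.
case: hj => ->; rewrite !vec4E !mxE /= fet ?(fe1 _ is_trans1) ?(fe1 _ is_trans2)
  ?(fe2 _ is_trans1) ?(fe2 _ is_trans2) ?(fs0 _ is_trans1) ?(fs0 _ is_trans2).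
  all: rewrite cancel Sa mulrACA -expr2 a2; ring.
Qed.

End Rigid.

(** * The isotropy group *)

Section CompactOpen.
Variables (T U : topologicalType).

(** Singletons are compact, so the preimage of an open set is one of the generating open sets. *)
Lemma eval_continuous (x : T) : continuous (fun f : {compact-open, T -> U} => f x).
Proof.
apply/continuousP => O oO.
rewrite (_ : _ @^-1` O = [set f : {compact-open, T -> U} | f @` [set x] `<=` O]).
  by apply: compact_open_open => //; exact: compact_set1.
by apply/seteqP; split => f /=; rewrite image_set1 sub1set inE.
Qed.

End CompactOpen.

Lemma continuous_sum (R : realType) (T : topologicalType) (W : normedModType R)
    (I : Type) (s : seq I) (f : I -> T -> W) :
  (forall i, continuous (f i)) -> continuous (fun x => \sum_(i <- s) f i x).
Proof.
move=> cf; elim: s => [|i s IH] x.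
  by under eq_fun do rewrite big_nil; exact: cvg_cst.
by under eq_fun do rewrite big_cons; exact: (cvgD (cf i x) (IH x)).
Qed.

Lemma continuous_mx (R : realType) (T : topologicalType) m n
    (f : T -> 'M[R]_(m, n)) :
  (forall i j, continuous (fun x => f x i j)) -> continuous f.
Proof.
move=> cf; rewrite (_ : f = fun x => \sum_i \sum_j f x i j *: delta_mx i j).
  apply: continuous_sum => i; apply: continuous_sum => j x.
  exact: (cvgZ (cf i j x) (cvg_cst _)).
by apply/funext => y; exact: matrix_sum_delta.
Qed.

Lemma semidirect_OJM (R : realType) (j11 j12 j22 : R) g h :
  semidirect (OJ j11 j12 j22) g -> semidirect (OJ j11 j12 j22) h ->
  semidirect (OJ j11 j12 j22) (semidirect_mul g h).
Proof.
move=> [g1 gO] [h1 hO]; split; last exact: OJM.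
by case: g1 h1 => /= -> [|] ->; rewrite ?mul1r ?mulN1r ?opprK; [left|right|right|left].
Qed.

(** * From plane-wave isometries to the isotropy group of G *)

Section Transfer.
Variables (R : realType) (k j11 j12 j22 : R) (S C : R -> R) (s0 : R).
Hypothesis k0 : k != 0.
Hypothesis j0 : j11 * j22 - j12 ^+ 2 != 0.
Hypothesis dS : forall x : R, is_derive x 1 S (C x).
Hypothesis dC : forall x : R, is_derive x 1 C (k * S x).
Hypothesis S0 : S 0 = 0.
Hypothesis C0 : C 0 = 1.
Hypothesis Ss0 : S s0 != 0.
Variables (G : lieGroup R 4) (g : 'rV[R]_4 -> 'M[R]_4) (c : R).
Variables (Phi Psi : 'rV[R]_4 -> 'rV[R]_4).
Hypothesis c0 : c != 0.
Hypothesis sPhi : smooth Phi.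
Hypothesis sPsi : smooth Psi.
Hypothesis PhiK : cancel Phi Psi.
Hypothesis PsiK : cancel Psi Phi.
Hypothesis Phi1 : Phi (lone G) = 0.

Local Notation plane_wave := (plane_wave k j11 j12 j22).
Local Notation pw_iso := (pw_iso j11 j12 j22 S C).
Local Notation OJ := (OJ j11 j12 j22).
Local Notation pw_param := (pw_param S s0).

Hypothesis metricE : forall p X Y,
  inner g p X Y = c * plane_wave (Phi p) ('d Phi p X) ('d Phi p Y).

Definition iso_param (f : {compact-open, 'rV[R]_4 -> 'rV[R]_4}) :
    R * 'M[R]_2 * 'cV[R]_2 :=
  pw_param (fun x => Phi (f (Psi x))).

Definition param_iso (h : R * 'M[R]_2 * 'cV[R]_2) :
    {compact-open, 'rV[R]_4 -> 'rV[R]_4} :=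
  fun x => Psi (pw_iso h (Phi x)).

Let diff (f : 'rV[R]_4 -> 'rV[R]_4) x : smooth f -> differentiable f x.
Proof. exact: smooth_differentiable. Qed.

Let diff2 (f h : 'rV[R]_4 -> 'rV[R]_4) x X : smooth f -> smooth h ->
  'd (fun y => h (f y)) x X = 'd h (f x) ('d f x X).
Proof. by move=> sf sh; exact: (diff_compE X (diff x sf) (diff (f x) sh)). Qed.

Let pw_congr (p p' x x' y y' : 'rV[R]_4) : p = p' -> x = x' -> y = y' ->
  c * plane_wave p x y = c * plane_wave p' x' y'.
Proof. by move=> -> -> ->. Qed.

Lemma iso_paramP f : isotropy G g f ->
  semidirect OJ (iso_param f) /\ param_iso (iso_param f) = f.
Proof.
move=> [[pf [f' [sf sf' fK f'K]]] f1].
have Psi0 : Psi 0 = lone G by rewrite -Phi1 PhiK.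
have sfP : smooth (fun x => f (Psi x)) by exact: smooth_comp.
have [||||||par E] := @pw_classify _ k j11 j12 j22 S C s0 k0 j0 dS dC S0 C0 Ss0
  (fun x => Phi (f (Psi x))) (fun x => Phi (f' (Psi x))).
- exact: smooth_comp.
- by apply: smooth_comp => //; exact: smooth_comp.
- by move=> x; rewrite PhiK fK PsiK.
- by move=> x; rewrite PhiK f'K PsiK.
- move=> q X Y; apply: (mulfI c0).
  have dE Z : 'd (fun x => Phi (f (Psi x))) q Z =
      'd Phi (f (Psi q)) ('d f (Psi q) ('d Psi q Z)).
    apply: etrans (diff2 q Z sfP sPhi) _.
    by congr ('d Phi _ _); exact: diff2.
  apply: etrans (pw_congr erefl (dE X) (dE Y)) _.
  apply: etrans (esym (metricE _ _ _)) _; apply: etrans (pf _ _ _) _.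
  apply: etrans (metricE _ _ _) _.
  have dK Z : 'd Phi (Psi q) ('d Psi q Z) = Z.
    by apply: diffK; [exact: PsiK|exact: diff..].
  by apply: pw_congr; [exact: PsiK|exact: dK..].
- by rewrite Psi0 f1 Phi1.
split; first exact: par.
by apply/funext => x; rewrite /param_iso /iso_param E /= !PhiK.
Qed.

Lemma param_isoP h : semidirect OJ h ->
  isotropy G g (param_iso h) /\ iso_param (param_iso h) = h.
Proof.
move=> Oh; have [h' [Oh' hh' h'h]] := semidirect_mulV j0 Oh.
have sF e := smooth_pw_iso j11 j12 j22 dS dC e.
have sP e : smooth (param_iso e : 'rV[R]_4 -> 'rV[R]_4).
  by apply: smooth_comp; [apply: smooth_comp; [exact: sPhi|exact: sF]|exact: sPsi].
have mulE := pw_iso_mul dS dC S0 C0.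
have id1 := pw_iso1 j11 j12 j22 S C.
split; last first.
  rewrite /iso_param (_ : (fun x => _) = pw_iso h); last first.
    by apply/funext => x; rewrite /param_iso !PsiK.
  exact: (pw_paramK dS dC S0 C0 Ss0 Oh).
split; first split.
- move=> p X Y.
  have dE Z : 'd Phi (param_iso h p) ('d (param_iso h) p Z) =
      'd (pw_iso h) (Phi p) ('d Phi p Z).
    apply: etrans (esym (diff2 p Z (sP h) sPhi)) _.
    apply: etrans (diff2 p Z sPhi (sF h)).
    by congr ('d _ p Z); apply/funext => x; rewrite /param_iso PsiK.
  apply: etrans (metricE _ _ _) _; apply: etrans (esym (metricE _ _ _)).
  apply: etrans (pw_congr (PsiK _) (dE X) (dE Y)) _.
  apply: (congr1 (fun z => c * z)).
  exact: (preserves_pw_iso dS dC S0 C0 Oh (Phi p) ('d Phi p X) ('d Phi p Y)).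
- exists (param_iso h'); split => //.
  + by move=> x; rewrite /param_iso PsiK -mulE// h'h id1 PhiK.
  + by move=> x; rewrite /param_iso PsiK -mulE// hh' id1 PhiK.
- by rewrite /param_iso Phi1 pw_iso0// -Phi1 PhiK.
Qed.

(** Every parameter is a polynomial in coordinates of [Phi] at finitely many values of f. *)
Lemma iso_param_continuous : continuous iso_param.
Proof.
have ev x j : continuous (fun f : {compact-open, 'rV[R]_4 -> 'rV[R]_4} => Phi (f x) 0 j).
  have cj : continuous (fun y => Phi y 0 j : R).
    by apply: smooth_continuous; exact: smooth_coord.
  move=> f; exact: (continuous_comp (@eval_continuous _ _ x f) (cj (f x))).
have c1 : continuous (fun f => (iso_param f).1.1) by exact: ev.
have c2 : continuous (fun f => (iso_param f).1.2).
  apply: continuous_mx => i j; rewrite (_ : (fun _ => _) = fun f => Phi (f (Psi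
    (if j == 0 then vec4 0 1 0 0 else vec4 0 0 1 0))) 0 (if i == 0 then 1 else 2)).
    exact: ev.
  by apply/funext => h; rewrite mxE.
have c3 : continuous (fun f => (iso_param f).2).
  apply: continuous_mx => i j; rewrite (_ : (fun _ => _) = fun f => (S s0)^-1 *
    Phi (f (Psi (vec4 1 0 0 0))) 0 0 *
    Phi (f (Psi (s0 *: vec4 1 0 0 0))) 0 (if i == 0 then 1 else 2)).
    by move=> h; exact: (cvgM (cvgM (cvg_cst _) (ev _ _ h)) (ev _ _ h)).
  by apply/funext => h; rewrite mxE.
by move=> f; exact: (cvg_pair (cvg_pair (c1 f) (c2 f)) (c3 f)).
Qed.

(** [Ck 0] unfolds to continuity, so the closure lemmas for [Ck] prove joint continuity. *)
Lemma pw_iso_continuous :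
  continuous (fun hx : (R * 'M[R]_2 * 'cV[R]_2) * 'rV[R]_4 => pw_iso hx.1 hx.2).
Proof.
pose T : normedModType R := (R * 'M[R]_2 * 'cV[R]_2 * 'rV[R]_4)%type.
have c11 : continuous (fun z : T => z.1.1).
  by move=> z; exact: (@continuous_comp T _ _ fst fst z cvg_fst cvg_fst).
have c1 : Ck 0 (fun z : T => z.1.1.1 : R).
  by move=> z; exact: (@continuous_comp _ _ _ (fun z : T => z.1.1) fst _ (c11 z) cvg_fst).
have c2 i j : Ck 0 (fun z : T => z.1.1.2 i j : R).
  have h : continuous (fun z : T => z.1.1.2).
    by move=> z; exact: (@continuous_comp _ _ _ (fun z : T => z.1.1) snd _ (c11 z) cvg_snd).
  by move=> z; exact: (continuous_comp (h z) (@coord_continuous _ _ _ i j _)).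
have c3 i : Ck 0 (fun z : T => z.1.2 i 0 : R).
  have h : continuous (fun z : T => z.1.2).
    by move=> z; exact: (@continuous_comp _ _ _ (fun z : T => z.1) snd _ cvg_fst cvg_snd).
  by move=> z; exact: (continuous_comp (h z) (@coord_continuous _ _ _ i 0 _)).
have c4 i : Ck 0 (fun z : T => z.2 0 i : R).
  by move=> z; exact: (@continuous_comp _ _ _ (fun z : T => z.2) _ _ cvg_snd (@coord_continuous _ _ _ 0 i _)).
have cSC (f : T -> R) : Ck 0 f -> Ck 0 (fun z => S (f z)) /\ Ck 0 (fun z => C (f z)).
  exact: (Ck_SC dS dC).
have vec (a b d e : T -> R) : Ck 0 a -> Ck 0 b -> Ck 0 d -> Ck 0 e ->
    Ck 0 (fun z => vec4 (a z) (b z) (d z) (e z)).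
  move=> ca cb cd ce; apply: Ck_mx => i -[[|[|[|[|//]]]] j4];
  by under eq_fun do rewrite mxE.
have gen (a m1 m2 m3 m4 b1 b2 x0 x1 x2 x3 : T -> R) :
    Ck 0 a -> Ck 0 m1 -> Ck 0 m2 -> Ck 0 m3 -> Ck 0 m4 -> Ck 0 b1 -> Ck 0 b2 ->
    Ck 0 x0 -> Ck 0 x1 -> Ck 0 x2 -> Ck 0 x3 ->
    Ck 0 (fun z => shear j11 j12 j22 S C (vec4 0 (b1 z) (b2 z) 0)
      (vec4 (a z * x0 z) (m1 z * x1 z + m2 z * x2 z) (m3 z * x1 z + m4 z * x2 z)
        (a z * x3 z))).
  move=> *; rewrite /shear /bil; under eq_fun do rewrite !vec4E.
  by apply: vec; repeat first [ assumption | exact: Ck_cst | apply: CkN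
    | apply: CkD | apply: CkM | apply: (cSC _ _).1 | apply: (cSC _ _).2 ].
exact: (gen _ _ _ _ _ _ _ _ _ _ _ c1 (c2 0 0) (c2 0 1) (c2 1 0) (c2 1 1) (c3 0) (c3 1)
  (c4 0) (c4 1) (c4 2) (c4 3)).
Qed.

(** Joint continuity in the parameters and the point curries to continuity into the compact-open
    topology. *)
Lemma param_iso_continuous : continuous param_iso.
Proof.
apply: (@continuous_curry_fun _ _ _
  (fun hx : (R * 'M[R]_2 * 'cV[R]_2) * 'rV[R]_4 => Psi (pw_iso hx.1 (Phi hx.2)))) => hx.
have cPsi := smooth_continuous sPsi; have cPhi := smooth_continuous sPhi.
apply: (@continuous_comp _ _ _ (fun hx : (R * 'M[R]_2 * 'cV[R]_2) * 'rV[R]_4 =>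
  pw_iso hx.1 (Phi hx.2)) Psi); last exact: cPsi.
apply: (@continuous_comp _ _ _ (fun hx : (R * 'M[R]_2 * 'cV[R]_2) * 'rV[R]_4 =>
  (hx.1, Phi hx.2)) (fun hx => pw_iso hx.1 hx.2)); last exact: pw_iso_continuous.
exact: (cvg_pair cvg_fst (@continuous_comp _ _ _ snd Phi hx cvg_snd (cPhi _))).
Qed.

Lemma isotropy_isomorphic : topological_group_isomorphic (isotropy G g)
  (@compose R 4) (semidirect OJ) (@semidirect_mul R).
Proof.
exists iso_param, param_iso; split; split.
- by move=> f /iso_paramP[].
- by move=> h /param_isoP[].
- by move=> f /set_mem /iso_paramP[].
- by move=> h /set_mem /param_isoP[].
- move=> f f' /set_mem /iso_paramP[Of Ef] /set_mem /iso_paramP[Of' Ef'].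
  have Off := semidirect_OJM Of Of'.
  rewrite -[RHS](param_isoP Off).2; congr iso_param.
  rewrite -[in LHS]Ef -[in LHS]Ef'; apply/funext => x.
  by rewrite /compose /param_iso /= PsiK (pw_iso_mul dS dC S0 C0).
- exact/continuous_subspaceT/iso_param_continuous.
- exact/continuous_subspaceT/param_iso_continuous.
Qed.

Lemma iso_param_id : iso_param id = (1, 1%:M, 0).
Proof.
have O1 : semidirect OJ (1, 1%:M, 0) by split; [left|exact: OJ1].
rewrite -[RHS](param_isoP O1).2; congr iso_param; apply/funext => x.
by rewrite /param_iso pw_iso1 PhiK.
Qed.

(** A connected set of isometries containing the identity is mapped by chi onto an interval that
    avoids 0, so the sign of chi cannot change. *)
Lemma component_pos (chi : R * 'M[R]_2 * 'cV[R]_2 -> R) : continuous chi ->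
  (forall h, semidirect OJ h -> chi h != 0) -> 0 < chi (1, 1%:M, 0) ->
  forall f, connected_component (isotropy G g) id f -> 0 < chi (iso_param f).
Proof.
move=> cchi chi0 chi1 f [B [B1 BG cB] Bf].
rewrite ltNge; apply/negP => le0.
have cB' : connected ((fun f => chi (iso_param f)) @` B).
  apply: connected_continuous_connected => //.
  have cchi' : continuous (fun f => chi (iso_param f)).
    move=> h; exact: (@continuous_comp _ _ _ iso_param chi h
      (@iso_param_continuous h) (cchi _)).
  exact: continuous_subspaceT.
have I := (connected_intervalP _).1 cB' (chi (iso_param f)) (chi (iso_param id)).
have [||| h] := I _ _ 0; first by exists f.
- by exists id.
- by rewrite le0 iso_param_id ltW.
by move=> Bh /eqP; apply/negP/chi0; have [] := iso_paramP (BG _ Bh).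
Qed.

End Transfer.

(** * Inner automorphisms *)

(** Meant for the slices x |-> (a, x) and x |-> (x, a), whose target is a product and not a space of
    row vectors, so that [Ck_comp] does not apply. The constant differential keeps all directions
    fixed. *)
Lemma Ck_affine (R : realType) (U V W : normedModType R) k (f : U -> V) (L : U -> V)
    (h : V -> W) :
  (forall x v, has_diff f x v (L v)) -> Ck k h -> Ck k (fun x => h (f x)).
Proof.
move=> df; have cf : continuous f.
  by move=> x; apply: differentiable_continuous; have [] := df x 0.
elim: k h => [|k IH] h.
  by move=> ch x; apply: continuous_comp; [exact: cf|exact: ch].
move=> [dh Cdh].
have E x v := has_diff_comp (df x v) (dh (f x)).
split=> [x|v]; first by have [] := E x 0.
rewrite (_ : (fun x => _) = fun x => 'd h (f x) (L v)); first exact: (IH _ (Cdh (L v))).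
by apply/funext => x; have [_] := E x v.
Qed.

Section LieGroupTheory.
Variables (R : realType) (n : nat) (G : lieGroup R n).
Local Notation "x ** y" := (lmul G x y) (at level 40, left associativity).
Local Notation inv := (linv G).
Local Notation one := (lone G).

Lemma lmulI x y z : x ** y = x ** z -> y = z.
Proof. by move=> /(congr1 (lmul G (inv x))); rewrite !lmulA lmulV !lmul1. Qed.

Lemma lmulr1 x : x ** one = x.
Proof. by apply: (@lmulI (inv x)); rewrite lmulA lmulV lmul1. Qed.

Lemma lmulrV x : x ** inv x = one.
Proof. by apply: (@lmulI (inv x)); rewrite lmulA lmulV lmul1 lmulr1. Qed.

Lemma linvK x : inv (inv x) = x.
Proof. by apply: (@lmulI (inv x)); rewrite lmulrV lmulV. Qed.

Lemma linv1 : inv one = one.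
Proof. by rewrite -[LHS]lmulr1 lmulV. Qed.

Lemma smooth_mull a : smooth (fun x => a ** x).
Proof.
move=> k; apply: (@Ck_affine _ _ _ _ k (fun x => (a, x)) (fun v => (0, v))
  (fun xy => xy.1 ** xy.2)) => [x v|]; last exact: smooth_lmul.
have da : differentiable (fun _ : 'rV[R]_n => a) x by exact: differentiable_cst.
have [di Ei] := has_diff_id x v.
split; first exact: differentiable_pair.
apply: etrans (congr1 (fun F => F v) (diff_pair da di)) _.
by apply: congr2; [exact: (congr1 (fun F => F v) (diff_cst a x))|exact: Ei].
Qed.

Lemma smooth_mulr a : smooth (fun x => x ** a).
Proof.
move=> k; apply: (@Ck_affine _ _ _ _ k (fun x => (x, a)) (fun v => (v, 0))
  (fun xy => xy.1 ** xy.2)) => [x v|]; last exact: smooth_lmul.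
have da : differentiable (fun _ : 'rV[R]_n => a) x by exact: differentiable_cst.
have [di Ei] := has_diff_id x v.
split; first exact: differentiable_pair.
apply: etrans (congr1 (fun F => F v) (diff_pair di da)) _.
by apply: congr2; [exact: Ei|exact: (congr1 (fun F => F v) (diff_cst a x))].
Qed.

Definition inner_aut (a x : 'rV[R]_n) : 'rV[R]_n := a ** x ** inv a.

Lemma smooth_inner_aut a : smooth (inner_aut a).
Proof. exact: (smooth_comp (smooth_mull a) (smooth_mulr (inv a))). Qed.

Lemma inner_autK a : cancel (inner_aut a) (inner_aut (inv a)).
Proof.
move=> x; rewrite /inner_aut linvK !lmulA lmulV lmul1.
by rewrite -lmulA lmulV lmulr1.
Qed.

Lemma preserves_metric_comp g (f h : 'rV[R]_n -> 'rV[R]_n) : smooth f -> smooth h ->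
  preserves_metric g f -> preserves_metric g h -> preserves_metric g (fun x => h (f x)).
Proof.
move=> sf sh pf ph p X Y.
have E Z : 'd (fun x => h (f x)) p Z = 'd h (f p) ('d f p Z).
  exact: diff_compE Z (smooth_differentiable p sf) (smooth_differentiable (f p) sh).
apply: etrans (congr2 (inner g _) (E X) (E Y)) _.
exact: etrans (ph _ _ _) (pf _ _ _).
Qed.

Variable g : 'rV[R]_n -> 'M[R]_n.
Hypothesis hg : bi_invariant_metric G g.

Lemma inner_aut_isotropy a : isotropy G g (inner_aut a).
Proof.
split; last by rewrite /inner_aut lmulr1 lmulrV.
split; last first.
  exists (inner_aut (inv a)); split; [exact: smooth_inner_aut..|exact: inner_autK|].
  by rewrite -[X in cancel _ (inner_aut X)]linvK; exact: inner_autK.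
apply: (preserves_metric_comp (smooth_mull a) (smooth_mulr (inv a))).
- exact: (hg.2 a).1.
- exact: (hg.2 (inv a)).2.
Qed.

(** The global chart is all of R^n, so the straight line through the identity and a is a path in the
    group; currying makes conjugation along it continuous. *)
Lemma inner_aut_component a : connected_component (isotropy G g) id (inner_aut a).
Proof.
pose path (s : R) : 'rV[R]_n := one + s *: (a - one).
pose F (s : R) : {compact-open, 'rV[R]_n -> 'rV[R]_n} := inner_aut (path s).
exists (range F); last by exists 1; rewrite // /F /path scale1r addrC subrK.
split.
- exists 0 => //; apply/funext => x.
  by rewrite /F /path scale0r addr0 /inner_aut lmul1 linv1 lmulr1.
- by move=> _ [s _ <-]; exact: inner_aut_isotropy.
apply: connected_continuous_connected.
  by apply/connected_intervalP.
apply: continuous_subspaceT.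
apply: (@continuous_curry_fun _ _ _ (fun sx => inner_aut (path sx.1) sx.2)) => z.
have cpath : continuous path.
  move=> s; apply: differentiable_continuous; have [] // := has_diff_line one (a - one) s.
have cmul : continuous (fun xy : 'rV[R]_n * 'rV[R]_n => xy.1 ** xy.2).
  exact: (smooth_lmul G 0).
have cinv : continuous (linv G) by exact: (smooth_linv G 0).
have c1 : continuous (fun sx : R * 'rV[R]_n => path sx.1).
  by move=> x; exact: (@continuous_comp _ _ _ fst path x cvg_fst (cpath _)).
have c2 : continuous (fun sx : R * 'rV[R]_n => path sx.1 ** sx.2).
  move=> x; exact: (@continuous_comp _ _ _ (fun sx : R * 'rV[R]_n => (path sx.1, sx.2))
    (fun xy => xy.1 ** xy.2) x (cvg_pair (c1 x) cvg_snd) (cmul _)).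
have c3 : continuous (fun sx : R * 'rV[R]_n => inv (path sx.1)).
  by move=> x; exact: (@continuous_comp _ _ _ (fun sx => path sx.1) (linv G) x (c1 x) (cinv _)).
exact: (@continuous_comp _ _ _ (fun sx : R * 'rV[R]_n => (path sx.1 ** sx.2, inv (path sx.1)))
    (fun xy => xy.1 ** xy.2) z (cvg_pair (c2 z) (c3 z)) (cmul _)).
Qed.

End LieGroupTheory.

(** * Invariant symmetric forms *)

Section SymmetricForms.
Variables (R : realType) (B : 'rV[R]_4 -> 'rV[R]_4 -> R).
Hypothesis Blin : forall a X Y Z, B (a *: X + Y) Z = a * B X Z + B Y Z.
Hypothesis Bsym : forall X Y, B X Y = B Y X.

Local Notation e0 := (vec4 1 0 0 0 : 'rV[R]_4).
Local Notation e1 := (vec4 0 1 0 0 : 'rV[R]_4).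
Local Notation e2 := (vec4 0 0 1 0 : 'rV[R]_4).
Local Notation e3 := (vec4 0 0 0 1 : 'rV[R]_4).

Lemma form_vec4 a b c d a' b' c' d' :
  B (vec4 a b c d) (vec4 a' b' c' d') =
  a * a' * B e0 e0 + b * b' * B e1 e1 + c * c' * B e2 e2 + d * d' * B e3 e3 +
  (a * b' + b * a') * B e0 e1 + (a * c' + c * a') * B e0 e2 +
  (a * d' + d * a') * B e0 e3 + (b * c' + c * b') * B e1 e2 +
  (b * d' + d * b') * B e1 e3 + (c * d' + d * c') * B e2 e3.
Proof.
have E x y z t : vec4 x y z t = x *: e0 + (y *: e1 + (z *: e2 + (t *: e3 + 0))) :> 'rV[R]_4.
  by rewrite [RHS]vec4_eta !mxE /=; congr vec4; ring.
have B0 Z : B 0 Z = 0.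
  by have := Blin (-1) 0 0 Z; rewrite scaler0 addr0 mulN1r addNr.
have Bl x y z t Z : B (vec4 x y z t) Z = x * B e0 Z + (y * B e1 Z + (z * B e2 Z + t * B e3 Z)).
  by rewrite E !Blin B0 addr0.
rewrite Bl; have Br Z : B Z (vec4 a' b' c' d') = a' * B e0 Z + (b' * B e1 Z +
    (c' * B e2 Z + d' * B e3 Z)) by rewrite Bsym; exact: Bl.
rewrite !Br.
rewrite (Bsym e1 e0) (Bsym e2 e0) (Bsym e3 e0) (Bsym e2 e1) (Bsym e3 e1) (Bsym e3 e2).
ring.
Qed.

End SymmetricForms.

Section InvariantForms.
Variable R : realType.

(** Comparison with [left_field] encodes the adjoint action: the left field of X' and the right
    field of X agree at q exactly when X' is Ad of q^-1 applied to X. *)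
Definition right_field (H : lieGroup R 4) (X p : 'rV[R]_4) : 'rV[R]_4 :=
  'd (fun x => lmul H x p) (lone H) X.

Lemma right_field0 (X p : 'rV[R]_4) : right_field (G0 R) X p =
  vec4 (X 0 0) (X 0 1 - X 0 0 * p 0 2) (X 0 2 + X 0 0 * p 0 1)
    (X 0 3 + 2^-1 * (X 0 1 * p 0 2 - X 0 2 * p 0 1)).
Proof.
rewrite /right_field /= /mul0 /=; eapply diff_vec4_eq.
1-4: by repeat first [eapply has_diff_cos | eapply has_diff_sin | progress solve_has_diff].
by rewrite /= !mxE cos0 sin0; congr vec4; ring.
Qed.

Lemma right_field1 (X p : 'rV[R]_4) : right_field (G1 R) X p =
  vec4 (X 0 0) (X 0 1 + X 0 0 * p 0 1) (X 0 2 - X 0 0 * p 0 2)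
    (X 0 3 + 2^-1 * (X 0 1 * p 0 2 - X 0 2 * p 0 1)).
Proof.
rewrite /right_field /= /mul1 /=; eapply diff_vec4_eq.
1-4: by repeat first [eapply has_diff_expR | progress solve_has_diff].
by rewrite /= !mxE oppr0 expR0; congr vec4; ring.
Qed.

(** Forms are functions instead of Gram matrices because the metric transported from G is available
    only as a pairing. *)
Definition invariant_form (H : lieGroup R 4) (h : 'rV[R]_4 -> 'rV[R]_4 -> 'rV[R]_4 -> R) :=
  [/\ forall q a X Y Z, h q (a *: X + Y) Z = a * h q X Z + h q Y Z,
      forall q X Y, h q X Y = h q Y X,
      forall q X Y, h q (left_field H X q) (left_field H Y q) = h (lone H) X Y &
      forall q X Y, h q (right_field H X q) (right_field H Y q) = h (lone H) X Y].

Local Notation e0 := (vec4 1 0 0 0 : 'rV[R]_4).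
Local Notation e1 := (vec4 0 1 0 0 : 'rV[R]_4).
Local Notation e2 := (vec4 0 0 1 0 : 'rV[R]_4).
Local Notation e3 := (vec4 0 0 0 1 : 'rV[R]_4).

(** At the identity the form is Ad-invariant, which leaves only the values on (e1, e1) and (e0, e0)
    free; these are b and a. *)
Lemma invariant_form0 h : invariant_form (G0 R) h -> exists b a : R,
  forall q X Y, h q X Y = b * inner (@metric0 R) q X Y + a * (X 0 0 * Y 0 0).
Proof.
case=> hlin hsym hl hr; pose B := h 0.
have := form_vec4 (hlin 0) (hsym 0); rewrite -/B.
move: (B e0 e0) (B e1 e1) (B e2 e2) (B e3 e3) (B e0 e1) (B e0 e2) (B e0 e3) (B e1 e2)
  (B e1 e3) (B e2 e3) => b00 b11 b22 b33 b01 b02 b03 b12 b13 b23 Bv.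
have Ad q X Y X' Y' : left_field (G0 R) X' q = right_field (G0 R) X q ->
    left_field (G0 R) Y' q = right_field (G0 R) Y q -> B X Y = B X' Y'.
  by move=> EX EY; apply: etrans (esym (hr q X Y)) _; rewrite -EX -EY; exact: hl.
pose v a b c d : 'rV[R]_4 := vec4 a b c d.
(* Three group elements replace infinitesimal invariance: a half turn and a quarter turn of span
   (e1, e2), and the exponential of e1, whose inverse acts by exp(- ad e1). *)
have Adpi a b c d : left_field (G0 R) (v a (- b) (- c) d) (v pi 0 0 0) =
    right_field (G0 R) (v a b c d) (v pi 0 0 0).
  by rewrite left_field0 right_field0 !vec4E cospi sinpi; congr vec4; ring.
have Adpi2 a b c d : left_field (G0 R) (v a c (- b) d) (v (pi / 2) 0 0 0) =
    right_field (G0 R) (v a b c d) (v (pi / 2) 0 0 0).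
  by rewrite left_field0 right_field0 !vec4E cos_pihalf sin_pihalf; congr vec4; ring.
have Adv a b c d : left_field (G0 R) (v a b (c + a) (d - c - 2^-1 * a)) (v 0 1 0 0) =
    right_field (G0 R) (v a b c d) (v 0 1 0 0).
  by rewrite left_field0 right_field0 !vec4E cos0 sin0; congr vec4; field.
have r1 a b c d a' b' c' d' := Ad _ _ _ _ _ (Adpi a b c d) (Adpi a' b' c' d').
have r2 a b c d a' b' c' d' := Ad _ _ _ _ _ (Adpi2 a b c d) (Adpi2 a' b' c' d').
have r3 a b c d a' b' c' d' := Ad _ _ _ _ _ (Adv a b c d) (Adv a' b' c' d').
have E01 : b01 = 0 by have := r1 1 0 0 0 0 1 0 0; rewrite /v !Bv; lra.
have E02 : b02 = 0 by have := r1 1 0 0 0 0 0 1 0; rewrite /v !Bv; lra.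
have E13 : b13 = 0 by have := r1 0 0 0 1 0 1 0 0; rewrite /v !Bv; lra.
have E23 : b23 = 0 by have := r1 0 0 0 1 0 0 1 0; rewrite /v !Bv; lra.
have E12 : b12 = 0 by have := r2 0 1 0 0 0 0 1 0; rewrite /v !Bv; lra.
have E22 : b22 = b11 by have := r2 0 1 0 0 0 1 0 0; rewrite /v !Bv; lra.
have E33 : b33 = 0 by have := r3 0 0 1 0 0 0 0 1; rewrite /v !Bv; lra.
have E03 : b03 = b11 by have := r3 1 0 0 0 0 0 1 0; rewrite /v !Bv; lra.
exists b11, b00 => q X Y.
(* Left-invariant fields span the tangent space at q and keep the t component, so the identity found
   at the neutral element propagates to q together with its dt^2 term. *)
have surj Z : exists2 Z', left_field (G0 R) Z' q = Z & Z' 0 0 = Z 0 0.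
  exists (v (Z 0 0) (cos (q 0 0) * Z 0 1 + sin (q 0 0) * Z 0 2)
    (- sin (q 0 0) * Z 0 1 + cos (q 0 0) * Z 0 2)
    (Z 0 3 - 2^-1 * (q 0 1 * Z 0 2 - q 0 2 * Z 0 1))); last by rewrite vec4E.
  have e (x : R) : x = (cos (q 0 0) ^+ 2 + sin (q 0 0) ^+ 2) * x by rewrite cos2Dsin2 mul1r.
  rewrite left_field0 !vec4E [RHS]vec4_eta; congr vec4.
  - by rewrite [RHS]e; ring.
  - by rewrite [RHS]e; ring.
  - by rewrite [X in _ - _ * (_ * X - _)]e [X in _ - _ * (_ - _ * X)]e; ring.
have [X' <- X0] := surj X; have [Y' <- Y0] := surj Y.
have il : inner (@metric0 R) q (left_field (G0 R) X' q) (left_field (G0 R) Y' q) =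
    inner (@metric0 R) 0 X' Y'.
  have := ((bi_invariant_metric0 R).2 q).1 0 X' Y'.
  by have -> : lmul (G0 R) q 0 = q by exact: (lmulr1 (G0 R) q).
rewrite il hl -/B (vec4_eta X') (vec4_eta Y') Bv inner0E !left_field0 !vec4E.
rewrite E01 E02 E13 E23 E12 E22 E33 E03 !mxE; ring.
Qed.

Lemma invariant_form1 h : invariant_form (G1 R) h -> exists b a : R,
  forall q X Y, h q X Y = b * inner (@metric1 R) q X Y + a * (X 0 0 * Y 0 0).
Proof.
case=> hlin hsym hl hr; pose B := h 0.
have := form_vec4 (hlin 0) (hsym 0); rewrite -/B.
move: (B e0 e0) (B e1 e1) (B e2 e2) (B e3 e3) (B e0 e1) (B e0 e2) (B e0 e3) (B e1 e2)
  (B e1 e3) (B e2 e3) => b00 b11 b22 b33 b01 b02 b03 b12 b13 b23 Bv.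
have Ad q X Y X' Y' : left_field (G1 R) X' q = right_field (G1 R) X q ->
    left_field (G1 R) Y' q = right_field (G1 R) Y q -> B X Y = B X' Y'.
  by move=> EX EY; apply: etrans (esym (hr q X Y)) _; rewrite -EX -EY; exact: hl.
pose v a b c d : 'rV[R]_4 := vec4 a b c d.
pose r := expR (1 : R); pose r' := expR (- 1 : R).
have rr' : r * r' = 1 by exact: expRxMexpNx_1.
have r1 : r != 1 by rewrite gt_eqF// expR_gt1 ltr01.
have r'E : r' = r^-1 by rewrite /r' expRN.
have rn0 : r != 0 by rewrite gt_eqF// expR_gt0.
have Adt a b c d : left_field (G1 R) (v a (r' * b) (r * c) d) (v 1 0 0 0) =
    right_field (G1 R) (v a b c d) (v 1 0 0 0).
  rewrite left_field1 right_field1 !vec4E -/r -/r' !mulrA [r' * r]mulrC rr'.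
  by congr vec4; ring.
have Adv a b c d : left_field (G1 R) (v a (b + a) c (d - c)) (v 0 1 0 0) =
    right_field (G1 R) (v a b c d) (v 0 1 0 0).
  by rewrite left_field1 right_field1 !vec4E oppr0 expR0; congr vec4; field.
have h1 a b c d a' b' c' d' := Ad _ _ _ _ _ (Adt a b c d) (Adt a' b' c' d').
have h2 a b c d a' b' c' d' := Ad _ _ _ _ _ (Adv a b c d) (Adv a' b' c' d').
(* Under [Adt] the vectors e1 and e2 are scaled by r' and r, while e0 and e3 are fixed. A product of
   basis vectors survives only if its total factor is 1, and neither r nor r^2 equals 1. *)
have key (x : R) : x = r * x -> x = 0.
  move=> /eqP; rewrite -subr_eq0 -{1}[x]mul1r -mulrBl mulf_eq0 subr_eq0 eq_sym.
  by rewrite (negPf r1) => /eqP.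
have key' (x : R) : x = r' * x -> x = 0.
  by move=> e; apply: key; rewrite [in RHS]e mulrA rr' mul1r.
have r2 : r ^+ 2 != 1.
  by rewrite sqrf_eq1 negb_or r1/= gt_eqF// (lt_trans _ (expR_gt0 _))// ltrN10.
have key2 (x : R) : x = r ^+ 2 * x -> x = 0.
  move=> /eqP; rewrite -subr_eq0 -{1}[x]mul1r -mulrBl mulf_eq0 subr_eq0 eq_sym.
  by rewrite (negPf r2) => /eqP.
have key2' (x : R) : x = r' ^+ 2 * x -> x = 0.
  by move=> e; apply: key2; rewrite [in RHS]e mulrA -exprMn rr' expr1n mul1r.
have E01 : b01 = 0 by apply: key'; have := h1 1 0 0 0 0 1 0 0; rewrite /v !Bv; lra.
have E02 : b02 = 0 by apply: key; have := h1 1 0 0 0 0 0 1 0; rewrite /v !Bv; lra.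
have E13 : b13 = 0 by apply: key'; have := h1 0 0 0 1 0 1 0 0; rewrite /v !Bv; lra.
have E23 : b23 = 0 by apply: key; have := h1 0 0 0 1 0 0 1 0; rewrite /v !Bv; lra.
have E11 : b11 = 0 by apply: key2'; have := h1 0 1 0 0 0 1 0 0; rewrite /v !Bv; lra.
have E22 : b22 = 0 by apply: key2; have := h1 0 0 1 0 0 0 1 0; rewrite /v !Bv; lra.
have E33 : b33 = 0 by have := h2 0 0 1 0 0 0 1 0; rewrite /v !Bv; lra.
have E03 : b03 = b12 by have := h2 1 0 0 0 0 0 1 0; rewrite /v !Bv; lra.
exists b12, b00 => q X Y.
have surj Z : exists2 Z', left_field (G1 R) Z' q = Z & Z' 0 0 = Z 0 0.
  exists (v (Z 0 0) (expR (- q 0 0) * Z 0 1) (expR (q 0 0) * Z 0 2)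
    (Z 0 3 - 2^-1 * (q 0 1 * Z 0 2 - q 0 2 * Z 0 1))); last by rewrite vec4E.
  have e (x : R) : expR (q 0 0) * (expR (- q 0 0) * x) = x.
    by rewrite mulrA expRxMexpNx_1 mul1r.
  have e' (x : R) : expR (- q 0 0) * (expR (q 0 0) * x) = x.
    by rewrite mulrCA e.
  by rewrite left_field1 !vec4E [RHS]vec4_eta !e !e'; congr vec4; ring.
have [X' <- X0] := surj X; have [Y' <- Y0] := surj Y.
have il : inner (@metric1 R) q (left_field (G1 R) X' q) (left_field (G1 R) Y' q) =
    inner (@metric1 R) 0 X' Y'.
  have := ((bi_invariant_metric1 R).2 q).1 0 X' Y'.
  by have -> : lmul (G1 R) q 0 = q by exact: (lmulr1 (G1 R) q).
rewrite il hl -/B (vec4_eta X') (vec4_eta Y') Bv inner1E !left_field1 !vec4E.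
rewrite E01 E02 E13 E23 E11 E22 E33 E03 !mxE; ring.
Qed.

End InvariantForms.

(** * Transport of the metric to the model group *)

Section PullBack.
Variables (R : realType) (G H : lieGroup R 4) (g : 'rV[R]_4 -> 'M[R]_4).
Variables (phi psi : 'rV[R]_4 -> 'rV[R]_4).
Hypothesis hg : bi_invariant_metric G g.
Hypothesis sphi : smooth phi.
Hypothesis spsi : smooth psi.
Hypothesis phiK : cancel phi psi.
Hypothesis psiK : cancel psi phi.
Hypothesis phiM : forall x y, phi (lmul G x y) = lmul H (phi x) (phi y).

Lemma psiM x y : psi (lmul H x y) = lmul G (psi x) (psi y).
Proof. by rewrite -{1}[x]psiK -{1}[y]psiK -phiM phiK. Qed.

Lemma phi_one : phi (lone G) = lone H.
Proof. by apply: (@lmulI _ _ H (phi (lone G))); rewrite -phiM lmul1 lmulr1. Qed.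

Lemma psi_one : psi (lone H) = lone G.
Proof. by rewrite -phi_one phiK. Qed.

Lemma psiV x : psi (linv H x) = linv G (psi x).
Proof. by apply: (@lmulI _ _ G (psi x)); rewrite -psiM !lmulrV psi_one. Qed.

Definition pull_back (q X Y : 'rV[R]_4) : R := inner g (psi q) ('d psi q X) ('d psi q Y).

Lemma pull_backE p X Y : inner g p X Y = pull_back (phi p) ('d phi p X) ('d phi p Y).
Proof.
have dK Z : 'd psi (phi p) ('d phi p Z) = Z.
  by apply: diffK; [exact: phiK|exact: smooth_differentiable..].
apply: etrans (esym (congr2 (inner g p) (dK X) (dK Y))) _.
exact: (congr1 (fun p' => inner g p' _ _) (esym (phiK p))).
Qed.

Lemma innerP p a X Y Z : inner g p (a *: X + Y) Z = a * inner g p X Z + inner g p Y Z.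
Proof. by rewrite /inner !mulmxDl -!scalemxAl !mxE. Qed.

Lemma inner_sym p X Y : inner g p X Y = inner g p Y X.
Proof.
have [sg _] := hg.1.2 p; rewrite /inner -[in LHS](trmxK (X *m g p *m Y^T)) mxE.
by rewrite !trmx_mul trmxK sg mulmxA.
Qed.

Let diff2 (f h : 'rV[R]_4 -> 'rV[R]_4) x X : smooth f -> smooth h ->
  'd (fun y => h (f y)) x X = 'd h (f x) ('d f x X).
Proof.
by move=> sf sh; exact: (diff_compE X (smooth_differentiable x sf)
  (smooth_differentiable (f x) sh)).
Qed.

Let diff_at (f : 'rV[R]_4 -> 'rV[R]_4) p p' X : p = p' -> 'd f p X = 'd f p' X.
Proof. by move=> ->. Qed.

Lemma pull_back_invariant : invariant_form H pull_back.
Proof.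
split.
- move=> q a X Y Z; apply: etrans _ (innerP _ _ _ _ _).
  by apply: (congr1 (fun V => inner g (psi q) V _)); exact: linearP.
- by move=> q X Y; exact: inner_sym.
- move=> q X Y.
  have dE Z : 'd psi q (left_field H Z q) = 'd (lmul G (psi q)) (lone G) ('d psi (lone H) Z).
    apply: etrans (diff_at _ _ (esym (lmulr1 H q))) _.
    apply: etrans (esym (diff2 (lone H) Z (smooth_mull H q) spsi)) _.
    apply: etrans _ (diff_at _ _ psi_one).
    apply: etrans _ (diff2 (lone H) Z spsi (smooth_mull G (psi q))).
    exact: (congr1 (fun f : 'rV[R]_4 -> 'rV[R]_4 => 'd f (lone H) Z) (funext (psiM q))).
  apply: etrans (congr2 (inner g (psi q)) (dE X) (dE Y)) _.
  apply: etrans (congr1 (fun p => inner g p _ _) (esym (lmulr1 G (psi q)))) _.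
  apply: etrans ((hg.2 (psi q)).1 _ _ _) _.
  exact: (congr1 (fun p => inner g p _ _) (esym psi_one)).
- move=> q X Y.
  have dE Z : 'd psi q (right_field H Z q) =
      'd (fun x => lmul G x (psi q)) (lone G) ('d psi (lone H) Z).
    apply: etrans (diff_at _ _ (esym (lmul1 H q))) _.
    apply: etrans (esym (diff2 (lone H) Z (smooth_mulr H q) spsi)) _.
    apply: etrans _ (diff_at _ _ psi_one).
    apply: etrans _ (diff2 (lone H) Z spsi (smooth_mulr G (psi q))).
    exact: (congr1 (fun f : 'rV[R]_4 -> 'rV[R]_4 => 'd f (lone H) Z)
      (funext (fun x => psiM x q))).
  apply: etrans (congr2 (inner g (psi q)) (dE X) (dE Y)) _.
  apply: etrans (congr1 (fun p => inner g p _ _) (esym (lmul1 G (psi q)))) _.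
  apply: etrans ((hg.2 (psi q)).2 _ _ _) _.
  exact: (congr1 (fun p => inner g p _ _) (esym psi_one)).
Qed.

(** Serves to exclude a zero scale factor: a mere multiple of dt^2 would have e3 in its kernel. *)
Lemma pull_back_nondegenerate q X : (forall Y, pull_back q X Y = 0) -> X = 0.
Proof.
move=> h; have dK Z : 'd phi (psi q) ('d psi q Z) = Z.
  by apply: diffK; [exact: psiK|exact: smooth_differentiable..].
have dK' Z : 'd psi q ('d phi (psi q) Z) = Z.
  have := @diffK _ _ _ phi psi (psi q) Z phiK (smooth_differentiable _ sphi)
    (smooth_differentiable _ spsi).
  by rewrite psiK.
have [_ ug] := hg.1.2 (psi q).
have dX0 : 'd psi q X = 0.
  have U0 Z : inner g (psi q) ('d psi q X) Z = 0.
    exact: etrans (congr1 (fun V => inner g (psi q) _ V) (esym (dK' Z))) (h _).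
  move: ('d psi q X : 'rV[R]_4) U0 => U U0.
  rewrite -[LHS](mulmxK ug); suff -> : U *m g (psi q) = 0 by rewrite mul0mx.
  apply/rowP => j; have := U0 (delta_mx 0 j).
  rewrite /inner trmx_delta mxE (bigD1 j) //= big1 => [|i ij].
    by rewrite addr0 [delta_mx _ _ _ _]mxE !eqxx mulr1 => ->; rewrite mxE.
  by rewrite [delta_mx _ _ _ _]mxE (negPf ij) mulr0.
apply: etrans (esym (dK X)) _.
exact: etrans (congr1 (fun V => 'd phi (psi q) V) dX0) (linear0 _).
Qed.

End PullBack.

(** * Brinkmann coordinates *)

Section Brinkmann.
Variable R : realType.

(* The rotation by [- t / 2] (resp. the boost by [- t / 2]) of the plane
   span (e1, e2) removes the cross terms of the metric; the term [d t] absorbs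
   the value of the metric on (e0, e0). *)
Definition brinkmann0 (d : R) (x : 'rV[R]_4) : 'rV[R]_4 :=
  let h := 2^-1 * x 0 0 in
  vec4 (x 0 0) (cos h * x 0 1 + sin h * x 0 2) (- sin h * x 0 1 + cos h * x 0 2)
    (x 0 3 + d * x 0 0).

Definition brinkmann0_inv (d : R) (x : 'rV[R]_4) : 'rV[R]_4 :=
  let h := 2^-1 * x 0 0 in
  vec4 (x 0 0) (cos h * x 0 1 - sin h * x 0 2) (sin h * x 0 1 + cos h * x 0 2)
    (x 0 3 - d * x 0 0).

Definition brinkmann1 (d : R) (x : 'rV[R]_4) : 'rV[R]_4 :=
  let h := 2^-1 * x 0 0 in
  vec4 (x 0 0) (expR (- h) * x 0 1) (expR h * x 0 2) (x 0 3 + d * x 0 0).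

Definition brinkmann1_inv (d : R) (x : 'rV[R]_4) : 'rV[R]_4 :=
  let h := 2^-1 * x 0 0 in
  vec4 (x 0 0) (expR h * x 0 1) (expR (- h) * x 0 2) (x 0 3 - d * x 0 0).

Ltac solve_Ck := move=> k; repeat first
  [ exact: Ck_coord | exact: Ck_cst | apply: CkD | apply: CkM | apply: CkN
  | apply: Ck_expR | apply: Ck_cos | apply: Ck_sin ].

Lemma smooth_brinkmann0 d : smooth (brinkmann0 d).
Proof. by apply: smooth_vec4; solve_Ck. Qed.

Lemma smooth_brinkmann0_inv d : smooth (brinkmann0_inv d).
Proof. by apply: smooth_vec4; solve_Ck. Qed.

Lemma smooth_brinkmann1 d : smooth (brinkmann1 d).
Proof. by apply: smooth_vec4; solve_Ck. Qed.

Lemma smooth_brinkmann1_inv d : smooth (brinkmann1_inv d).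
Proof. by apply: smooth_vec4; solve_Ck. Qed.

Let cs1 (h x : R) : x = (cos h ^+ 2 + sin h ^+ 2) * x.
Proof. by rewrite cos2Dsin2 mul1r. Qed.

Lemma brinkmann0K d : cancel (brinkmann0 d) (brinkmann0_inv d).
Proof.
move=> x; rewrite /brinkmann0_inv /brinkmann0 !vec4E [RHS]vec4_eta.
congr vec4; [|..|by ring].
  by rewrite [RHS](cs1 (2^-1 * x 0 0)); ring.
by rewrite [RHS](cs1 (2^-1 * x 0 0)); ring.
Qed.

Lemma brinkmann0_invK d : cancel (brinkmann0_inv d) (brinkmann0 d).
Proof.
move=> x; rewrite /brinkmann0_inv /brinkmann0 !vec4E [RHS]vec4_eta.
congr vec4; [|..|by ring].
  by rewrite [RHS](cs1 (2^-1 * x 0 0)); ring.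
by rewrite [RHS](cs1 (2^-1 * x 0 0)); ring.
Qed.

Lemma brinkmann1K d : cancel (brinkmann1 d) (brinkmann1_inv d).
Proof.
move=> x; rewrite /brinkmann1_inv /brinkmann1 !vec4E [RHS]vec4_eta !mulrA.
by rewrite expRxMexpNx_1 [expR (- _) * _]mulrC expRxMexpNx_1; congr vec4; ring.
Qed.

Lemma brinkmann1_invK d : cancel (brinkmann1_inv d) (brinkmann1 d).
Proof.
move=> x; rewrite /brinkmann1_inv /brinkmann1 !vec4E [RHS]vec4_eta !mulrA.
by rewrite expRxMexpNx_1 [expR (- _) * _]mulrC expRxMexpNx_1; congr vec4; ring.
Qed.

Lemma brinkmann0_metric d p X Y :
  plane_wave (- 4^-1) 1 0 1 (brinkmann0 d p) ('d (brinkmann0 d) p X) ('d (brinkmann0 d) p Y) =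
  inner (@metric0 R) p X Y + 2 * d * (X 0 0 * Y 0 0).
Proof.
have dE Z : 'd (brinkmann0 d) p Z = let h := 2^-1 * p 0 0 in
  vec4 (Z 0 0) (cos h * (Z 0 1 + 2^-1 * Z 0 0 * p 0 2) + sin h * (Z 0 2 - 2^-1 * Z 0 0 * p 0 1))
   (cos h * (Z 0 2 - 2^-1 * Z 0 0 * p 0 1) - sin h * (Z 0 1 + 2^-1 * Z 0 0 * p 0 2))
   (Z 0 3 + d * Z 0 0).
  rewrite /brinkmann0 /=; eapply diff_vec4_eq.
  1-4: by repeat first [eapply has_diff_cos | eapply has_diff_sin | progress solve_has_diff].
  by rewrite /=; congr vec4; ring.
rewrite !dE (vec4_eta X) (vec4_eta Y) inner0E /plane_wave /bil /brinkmann0 !vec4E.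
have := cos2Dsin2 (2^-1 * p 0 0) => /(congr1 (fun z => z - sin (2^-1 * p 0 0) ^+ 2)).
by rewrite addrK; move: (cos _) (sin _) => c s cs; field: cs.
Qed.

Lemma brinkmann1_metric d p X Y :
  plane_wave (4^-1) 0 1 0 (brinkmann1 d p) ('d (brinkmann1 d) p X) ('d (brinkmann1 d) p Y) =
  inner (@metric1 R) p X Y + 2 * d * (X 0 0 * Y 0 0).
Proof.
have dE Z : 'd (brinkmann1 d) p Z = let h := 2^-1 * p 0 0 in
  vec4 (Z 0 0) (expR (- h) * (Z 0 1 - 2^-1 * Z 0 0 * p 0 1))
   (expR h * (Z 0 2 + 2^-1 * Z 0 0 * p 0 2)) (Z 0 3 + d * Z 0 0).
  rewrite /brinkmann1 /=; eapply diff_vec4_eq.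
  1-4: by repeat first [eapply has_diff_expR | progress solve_has_diff].
  by rewrite /=; congr vec4; ring.
rewrite !dE (vec4_eta X) (vec4_eta Y) inner1E /plane_wave /bil /brinkmann1 !vec4E.
have := expRxMexpNx_1 (2^-1 * p 0 0).
by move: (expR _) (expR (- _)) => c s cs; field: cs.
Qed.

End Brinkmann.

(** * The two groups *)

Lemma param_mx_continuous (R : realType) i j :
  continuous (fun h : R * 'M[R]_2 * 'cV[R]_2 => h.1.2 i j).
Proof.
have h2 : continuous (fun h : R * 'M[R]_2 * 'cV[R]_2 => h.1.2).
  move=> h; exact: (@continuous_comp _ _ _ (fun h : R * 'M[R]_2 * 'cV[R]_2 => h.1) snd h
    cvg_fst cvg_snd).
by move=> h; exact: (continuous_comp (h2 h) (@coord_continuous _ _ _ i j _)).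
Qed.

Section Model.
Variables (R : realType) (k j11 j12 j22 : R) (S C : R -> R) (s0 : R).
Hypothesis k0 : k != 0.
Hypothesis j0 : j11 * j22 - j12 ^+ 2 != 0.
Hypothesis dS : forall x : R, is_derive x 1 S (C x).
Hypothesis dC : forall x : R, is_derive x 1 C (k * S x).
Hypothesis S0 : S 0 = 0.
Hypothesis C0 : C 0 = 1.
Hypothesis Ss0 : S s0 != 0.
Local Notation OJ := (OJ j11 j12 j22).
Local Notation pw_param := (pw_param S s0).

Variables (H : lieGroup R 4) (mH : 'rV[R]_4 -> 'M[R]_4).
Variables (br br_inv : R -> 'rV[R]_4 -> 'rV[R]_4).
Hypothesis sbr : forall d, smooth (br d).
Hypothesis sbr_inv : forall d, smooth (br_inv d).
Hypothesis brK : forall d, cancel (br d) (br_inv d).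
Hypothesis br_invK : forall d, cancel (br_inv d) (br d).
Hypothesis br1 : forall d, br d (lone H) = 0.
Hypothesis br_metric : forall d p X Y,
  plane_wave k j11 j12 j22 (br d p) ('d (br d) p X) ('d (br d) p Y) =
  inner mH p X Y + 2 * d * (X 0 0 * Y 0 0).
Hypothesis formH : forall h, invariant_form H h -> exists b a : R,
  forall q X Y, h q X Y = b * inner mH q X Y + a * (X 0 0 * Y 0 0).

(* [\det] and [chi] together single out the identity component of [OJ]. *)
Variable chi : 'M[R]_2 -> R.
Hypothesis chi_cont : continuous (fun h : R * 'M[R]_2 * 'cV[R]_2 => chi h.1.2).
Hypothesis chi_neq0 : forall M, OJ M -> chi M != 0.
Hypothesis chi1 : 0 < chi 1%:M.
Hypothesis inner_realize : forall d M b, OJ M -> 0 < \det M -> 0 < chi M ->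
  exists q, pw_param (fun y => br d (inner_aut H q (br_inv d y))) = (1, M, b).

Variables (G : lieGroup R 4) (g : 'rV[R]_4 -> 'M[R]_4).
Hypothesis hg : bi_invariant_metric G g.
Hypothesis isoGH : lie_isomorphic G H.

(** Along the isomorphism with H the metric becomes one of the forms of [formH]. Its scale c stays
    as a harmless factor, and its dt^2 term is absorbed by d. *)
Lemma brinkmann_chart : exists (c d : R) phi psi,
  [/\ c != 0, smooth phi, smooth psi, cancel phi psi & cancel psi phi] /\
  [/\ forall x y, phi (lmul G x y) = lmul H (phi x) (phi y) &
  forall p X Y, inner g p X Y = c * plane_wave k j11 j12 j22 (br d (phi p))
    ('d (fun x => br d (phi x)) p X) ('d (fun x => br d (phi x)) p Y)].
Proof.
have [phi [psi [sphi spsi phiK psiK phiM]]] := isoGH.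
have inv := pull_back_invariant hg spsi phiK psiK phiM.
have [c [a hE]] := formH inv.
have c0 : c != 0.
  apply/eqP => c0; have := @pull_back_nondegenerate _ G g phi psi hg sphi spsi phiK psiK
    0 (vec4 0 0 0 1).
  have e3 Y : pull_back g psi 0 (vec4 0 0 0 1) Y = 0.
    by rewrite hE c0 vec4E !mul0r mulr0 addr0.
  move=> /(_ e3) /rowP /(_ 3); rewrite vec4E mxE => /eqP.
  by rewrite oner_eq0.
(* The value of d solves 2 c d = a, as [br_metric] requires. *)
exists c, (2^-1 * (c^-1 * a)), phi, psi; split=> //; split=> // p X Y.
set d := 2^-1 * _.
have dE Z : 'd (fun x => br d (phi x)) p Z = 'd (br d) (phi p) ('d phi p Z).
  exact: diff_compE Z (smooth_differentiable p sphi) (smooth_differentiable _ (sbr d)).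
apply: etrans (pull_backE g sphi spsi phiK p X Y) _.
apply: etrans (hE _ _ _) _.
apply: etrans _ (congr1 (fun z => c * z)
  (esym (congr2 (plane_wave k j11 j12 j22 _) (dE X) (dE Y)))).
apply: etrans _ (congr1 (fun z => c * z) (esym (br_metric _ _ _ _))).
rewrite mulrDr; congr (_ + _); move: ('d phi p X 0 0 * 'd phi p Y 0 0) => y.
by rewrite /d; field.
Qed.

Lemma model_isotropy_isomorphic : topological_group_isomorphic (isotropy G g)
  (@compose R 4) (semidirect OJ) (@semidirect_mul R).
Proof.
have [c [d [phi [psi [[c0 sphi spsi phiK psiK] [phiM gE]]]]]] := brinkmann_chart.
apply: (@isotropy_isomorphic R k j11 j12 j22 S C s0 k0 j0 dS dC S0 C0 Ss0 G g c
  (fun x => br d (phi x)) (fun x => psi (br_inv d x)) c0).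
- exact: smooth_comp.
- exact: smooth_comp.
- by move=> x; rewrite brK phiK.
- by move=> x; rewrite psiK br_invK.
- by rewrite (phi_one phiM) br1.
- exact: gE.
Qed.

(** [component_pos], applied to a, to the determinant and to [chi], leaves triples (1, M, b) that
    [inner_realize] attains by conjugations in H; [psi] carries these to conjugations in G. *)
Lemma model_component : connected_component (isotropy G g) id = inner_automorphisms G.
Proof.
have [c [d [phi [psi [[c0 sphi spsi phiK psiK] [phiM gE]]]]]] := brinkmann_chart.
pose Phi x := br d (phi x); pose Psi x := psi (br_inv d x).
have sPhi : smooth Phi by exact: smooth_comp.
have sPsi : smooth Psi by exact: smooth_comp.
have PhiK : cancel Phi Psi by move=> x; rewrite /Phi /Psi brK phiK.
have PsiK : cancel Psi Phi by move=> x; rewrite /Phi /Psi psiK br_invK.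
have Phi1 : Phi (lone G) = 0 by rewrite /Phi (phi_one phiM) br1.
have isoP := iso_paramP k0 j0 dS dC S0 C0 Ss0 c0 sPhi sPsi PhiK PsiK Phi1 gE.
have pos := component_pos k0 j0 dS dC S0 C0 Ss0 c0 sPhi sPsi PhiK PsiK Phi1 gE.
apply/seteqP; split => [f Cf|_ [a ->]]; last exact: inner_aut_component.
have If := connected_component_sub Cf.
have [[a1 OM] fE] := isoP f If.
set h := iso_param S s0 Phi Psi f in a1 OM fE.
have cm := @param_mx_continuous R.
have h1 : h.1.1 = 1.
  have cf : continuous (fun h : R * 'M[R]_2 * 'cV[R]_2 => h.1.1).
    move=> z; exact: (@continuous_comp _ _ _ (fun h : R * 'M[R]_2 * 'cV[R]_2 => h.1) fst z
      cvg_fst cvg_fst).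
  have nz (z : R * 'M[R]_2 * 'cV[R]_2) : semidirect OJ z -> z.1.1 != 0.
    by move=> [[|] -> _]; rewrite ?oppr_eq0 oner_neq0.
  have := pos (fun h => h.1.1) cf nz ltr01 f Cf; case: a1 => // ->.
  by rewrite ltr0N1.
have h2 : 0 < \det h.1.2.
  rewrite det2; apply: (pos (fun h => h.1.2 0 0 * h.1.2 1 1 - h.1.2 0 1 * h.1.2 1 0) _ _ _ f Cf).
  - by move=> z; exact: (cvgB (cvgM (cm 0 0 z) (cm 1 1 z)) (cvgM (cm 0 1 z) (cm 1 0 z))).
  - move=> z [_ /(OJ_unit j0)]; rewrite unitmxE unitfE det2; exact.
  - by rewrite -det2 det1 ltr01.
have h3 : 0 < chi h.1.2.
  by apply: (pos (fun h => chi h.1.2) _ _ _ f Cf) => // z [_ /chi_neq0].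
have [q Eq] := @inner_realize d h.1.2 h.2 OM h2 h3.
have isoq := isoP (inner_aut G (psi q)) (inner_aut_isotropy hg (psi q)).
exists (psi q); rewrite -[LHS]fE -[RHS]isoq.2; congr param_iso.
rewrite {1}/iso_param (_ : (fun x => _) = fun y => br d (inner_aut H q (br_inv d y))).
  by rewrite Eq -h1 -!surjective_pairing.
apply/funext => y; rewrite /Phi /Psi /inner_aut.
have psM := psiM phiK psiK phiM.
by rewrite -(psiV phiK psiK phiM) -!psM psiK.
Qed.

End Model.

Lemma mx2P (T : Type) (A B : 'M[T]_2) :
  A 0 0 = B 0 0 -> A 0 1 = B 0 1 -> A 1 0 = B 1 0 -> A 1 1 = B 1 1 -> A = B.
Proof.
move=> h00 h01 h10 h11; apply/matrixP => i j.
have I2 (l : 'I_2) : l = 0 \/ l = 1.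
  by case: l => -[|[|//]] hl; [left|right]; exact: val_inj.
by case: (I2 i) (I2 j) => -> [] ->.
Qed.

(** [acos] covers the half circle of nonnegative sine; the sign of s decides between [acos c] and
    its opposite. *)
Lemma angle_exists (R : realType) (c s : R) : c ^+ 2 + s ^+ 2 = 1 ->
  exists t, cos t = c /\ sin t = s.
Proof.
move=> cs1; have c1 : -1 <= c <= 1.
  by rewrite -ler_norml -(@ler_pXn2r _ 2) ?nnegrE// real_normK ?num_real// expr1n -cs1
    lerDl sqr_ge0.
have ss : Num.sqrt (1 - c ^+ 2) = `|s| by rewrite -cs1 addrAC subrr add0r sqrtr_sqr.
have [s_ge0|s_lt0] := leP 0 s.
  by exists (acos c); rewrite acosK// sin_acos// ss ger0_norm.
by exists (- acos c); rewrite cosN sinN acosK// sin_acos// ss ltr0_norm// opprK.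
Qed.

Section InnerAutomorphisms.
Variable R : realType.
Implicit Types (t a b : R) (x y : 'rV[R]_4).

Let mul0E1 x y : mul0 x y 0 1 = x 0 1 + (cos (x 0 0) * y 0 1 - sin (x 0 0) * y 0 2).
Proof. by rewrite /mul0 vec4E. Qed.
Let mul0E2 x y : mul0 x y 0 2 = x 0 2 + (sin (x 0 0) * y 0 1 + cos (x 0 0) * y 0 2).
Proof. by rewrite /mul0 vec4E. Qed.
Let mul1E1 x y : mul1 x y 0 1 = x 0 1 + expR (x 0 0) * y 0 1.
Proof. by rewrite /mul1 vec4E. Qed.
Let mul1E2 x y : mul1 x y 0 2 = x 0 2 + expR (- x 0 0) * y 0 2.
Proof. by rewrite /mul1 vec4E. Qed.

Lemma inner_aut0E0 t a b x : inner_aut (G0 R) (vec4 t a b 0) x 0 0 = x 0 0.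
Proof. by rewrite /inner_aut /= /mul0 /inv0 !vec4E; ring. Qed.

Lemma inner_aut0E1 t a b x : inner_aut (G0 R) (vec4 t a b 0) x 0 1 =
  a + (cos t * x 0 1 - sin t * x 0 2) - (cos (x 0 0) * a - sin (x 0 0) * b).
Proof.
rewrite /inner_aut /= !mul0E1 /inv0 !vec4E cosD sinD.
transitivity (a + (cos t * x 0 1 - sin t * x 0 2) -
  (cos t ^+ 2 + sin t ^+ 2) * (cos (x 0 0) * a - sin (x 0 0) * b)); first by ring.
by rewrite cos2Dsin2 mul1r.
Qed.

Lemma inner_aut0E2 t a b x : inner_aut (G0 R) (vec4 t a b 0) x 0 2 =
  b + (sin t * x 0 1 + cos t * x 0 2) - (sin (x 0 0) * a + cos (x 0 0) * b).
Proof.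
rewrite /inner_aut /= !mul0E2 /inv0 !vec4E cosD sinD.
transitivity (b + (sin t * x 0 1 + cos t * x 0 2) -
  (cos t ^+ 2 + sin t ^+ 2) * (sin (x 0 0) * a + cos (x 0 0) * b)); first by ring.
by rewrite cos2Dsin2 mul1r.
Qed.

Lemma inner_aut1E0 t a b x : inner_aut (G1 R) (vec4 t a b 0) x 0 0 = x 0 0.
Proof. by rewrite /inner_aut /= /mul1 /inv1 !vec4E; ring. Qed.

Lemma inner_aut1E1 t a b x : inner_aut (G1 R) (vec4 t a b 0) x 0 1 =
  a + expR t * x 0 1 - expR (x 0 0) * a.
Proof.
rewrite /inner_aut /= !mul1E1 /inv1 !vec4E expRD.
transitivity (a + expR t * x 0 1 - expR t * expR (- t) * (expR (x 0 0) * a)); first by ring.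
by rewrite expRxMexpNx_1 mul1r.
Qed.

Lemma inner_aut1E2 t a b x : inner_aut (G1 R) (vec4 t a b 0) x 0 2 =
  b + expR (- t) * x 0 2 - expR (- x 0 0) * b.
Proof.
rewrite /inner_aut /= !mul1E2 /inv1 !vec4E opprD expRD.
transitivity (b + expR (- t) * x 0 2 - expR t * expR (- t) * (expR (- x 0 0) * b)).
  by ring.
by rewrite expRxMexpNx_1 mul1r.
Qed.

End InnerAutomorphisms.

(** * The profiles S, C and the parameters of inner automorphisms *)

Section Models.
Variable R : realType.

(** The pairs are 2 sin(t/2), cos(t/2) and 2 sinh(t/2), cosh(t/2): the half angle comes from the
    Brinkmann coordinates, and the factor 2 gives S slope 1 at 0. *)
Let S_rot (t : R) := 2 * sin (2^-1 * t).
Let C_rot (t : R) := cos (2^-1 * t).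
Let S_boost (t : R) := expR (2^-1 * t) - expR (- (2^-1 * t)).
Let C_boost (t : R) := 2^-1 * (expR (2^-1 * t) + expR (- (2^-1 * t))).

Let half (t : R) : has_diff (fun t : R => 2^-1 * t) t 1 2^-1.
Proof.
eapply has_diff_eq; first exact: (has_diffM (has_diff_cst t 1 2^-1) (has_diff_id t (1 : R))).
by rewrite /=; ring.
Qed.

Let dS_rot (t : R) : is_derive t 1 S_rot (C_rot t).
Proof.
apply: is_derive_has_diff; eapply has_diff_eq.
  exact: (has_diffM (has_diff_cst t 1 2) (has_diff_sin (half t))).
by rewrite /C_rot /=; field.
Qed.

Let dC_rot (t : R) : is_derive t 1 C_rot (- 4^-1 * S_rot t).
Proof.
apply: is_derive_has_diff; eapply has_diff_eq; first exact: (has_diff_cos (half t)).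
by rewrite /S_rot /=; field.
Qed.

Let dS_boost (t : R) : is_derive t 1 S_boost (C_boost t).
Proof.
apply: is_derive_has_diff; eapply has_diff_eq.
  exact: (has_diffD (has_diff_expR (half t)) (has_diffN (has_diff_expR (has_diffN (half t))))).
by rewrite /C_boost /=; field.
Qed.

Let dC_boost (t : R) : is_derive t 1 C_boost (4^-1 * S_boost t).
Proof.
apply: is_derive_has_diff; eapply has_diff_eq.
  exact: (has_diffM (has_diff_cst t 1 2^-1)
    (has_diffD (has_diff_expR (half t)) (has_diff_expR (has_diffN (half t))))).
by rewrite /S_boost /=; field.
Qed.

Let S_rot0 : S_rot 0 = 0. Proof. by rewrite /S_rot mulr0 sin0 mulr0. Qed.
Let C_rot0 : C_rot 0 = 1. Proof. by rewrite /C_rot mulr0 cos0. Qed.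
Let S_boost0 : S_boost 0 = 0. Proof. by rewrite /S_boost mulr0 oppr0 subrr. Qed.
Let C_boost0 : C_boost 0 = 1.
Proof. by rewrite /C_boost mulr0 oppr0 expR0; field. Qed.

Let S_rot_pi : S_rot pi = 2.
Proof. by rewrite /S_rot mulrC [2^-1 * _]mulrC sin_pihalf mul1r. Qed.

Let S_boost1 : S_boost 1 != 0.
Proof. by rewrite /S_boost mulr1 subr_eq0 gt_eqF// ltr_expR; lra. Qed.

Let quarter_neq0 : 4^-1 != 0 :> R. Proof. by rewrite invr_eq0 pnatr_eq0. Qed.

Lemma OJ_O2 : OJ 1 0 1 = @O2 R.
Proof.
apply/seteqP; split => M; rewrite /O2 /=.
  move=> OM; have := OM (vec4 0 1 0 0) (vec4 0 1 0 0).
  have := OM (vec4 0 1 0 0) (vec4 0 0 1 0); have := OM (vec4 0 0 1 0) (vec4 0 0 1 0).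
  rewrite /bil /lin !vec4E => h3 h2 h1.
  by apply: mx2P; rewrite mx2E !mxE /=; lra.
move=> OM x y.
have := congr1 (fun A : 'M[R]_2 => A 1 1) OM; have := congr1 (fun A : 'M[R]_2 => A 0 1) OM.
have := congr1 (fun A : 'M[R]_2 => A 0 0) OM; rewrite !mx2E !mxE /= => h1 h2 h3.
rewrite /bil /lin !vec4E.
transitivity ((M 0 0 * M 0 0 + M 1 0 * M 1 0) * (x 0 1 * y 0 1) +
  (M 0 0 * M 0 1 + M 1 0 * M 1 1) * (x 0 1 * y 0 2 + x 0 2 * y 0 1) +
  (M 0 1 * M 0 1 + M 1 1 * M 1 1) * (x 0 2 * y 0 2)); first by ring.
by rewrite h1 h2 h3; ring.
Qed.

Let O11_entries M : OJ 0 1 0 M <-> [/\ M 0 0 * M 1 0 = 0 :> R, M 0 1 * M 1 1 = 0 &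
  M 0 0 * M 1 1 + M 0 1 * M 1 0 = 1].
Proof.
split=> [OM|[h1 h2 h3] x y].
  have := OM (vec4 0 1 0 0) (vec4 0 1 0 0).
  have := OM (vec4 0 1 0 0) (vec4 0 0 1 0); have := OM (vec4 0 0 1 0) (vec4 0 0 1 0).
  by rewrite /bil /lin !vec4E => h3 h2 h1; split; lra.
rewrite /bil /lin !vec4E.
transitivity (2 * (M 0 0 * M 1 0) * (x 0 1 * y 0 1) +
  (M 0 0 * M 1 1 + M 0 1 * M 1 0) * (x 0 1 * y 0 2 + x 0 2 * y 0 1) +
  2 * (M 0 1 * M 1 1) * (x 0 2 * y 0 2)); first by ring.
by rewrite h1 h2 h3; ring.
Qed.

Lemma OJ_O11 : OJ 0 1 0 = @O11 R.
Proof.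
apply/seteqP; split => M; rewrite /O11 /=.
  move=> OM; split; first by apply: OJ_unit OM; rewrite expr1n mul0r sub0r oppr_eq0 oner_neq0.
  have [h1 h2 h3] := (O11_entries M).1 OM => w; rewrite /q11 !mx2E.
  transitivity (2 * (M 0 0 * M 1 0) * (w 0 0) ^+ 2 + 2 * (M 0 1 * M 1 1) * (w 1 0) ^+ 2 +
    2 * (M 0 0 * M 1 1 + M 0 1 * M 1 0) * (w 0 0 * w 1 0)); first by ring.
  by rewrite h1 h2 h3; ring.
move=> [_ qM]; apply/O11_entries.
(* Polarisation: the quadratic form is tested on (1, 0), (0, 1) and (1, 1). *)
pose w a b : 'cV[R]_2 := \col_i (if i == 0 then a else b).
have := qM (w 1 0); have := qM (w 0 1); have := qM (w 1 1).
by rewrite /q11 !mx2E !mxE /= => h3 h2 h1; split; lra.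
Qed.

(** For O(2) the determinant already separates the two components, so [chi] is taken to be
    [\det]. *)
Let realize0 d M b : OJ 1 0 1 M -> 0 < \det M -> 0 < \det M ->
  exists q, pw_param S_rot pi
    (fun y => brinkmann0 d (inner_aut (G0 R) q (brinkmann0_inv d y))) = (1, M, b).
Proof.
rewrite OJ_O2 det2 => OM D0 _.
have := congr1 (fun A : 'M[R]_2 => A 1 1) OM; have := congr1 (fun A : 'M[R]_2 => A 0 1) OM.
have := congr1 (fun A : 'M[R]_2 => A 0 0) OM; rewrite !mx2E !mxE /= => h1 h2 h3.
set D := M 0 0 * _ - _ in D0.
have D1 : D = 1.
  have : D ^+ 2 = 1.
    transitivity ((M 0 0 * M 0 0 + M 1 0 * M 1 0) * (M 0 1 * M 0 1 + M 1 1 * M 1 1) -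
      (M 0 0 * M 0 1 + M 1 0 * M 1 1) ^+ 2); first by rewrite /D; ring.
    by rewrite h1 h2 h3; ring.
  by move=> /eqP; rewrite sqrf_eq1 => /orP[/eqP//|/eqP DN]; move: D0; rewrite DN ltr0N1.
have M11 : M 1 1 = M 0 0.
  transitivity (M 1 1 * (M 0 0 * M 0 0 + M 1 0 * M 1 0) -
    M 1 0 * (M 0 0 * M 0 1 + M 1 0 * M 1 1)); first by rewrite h1 h2; ring.
  by rewrite -[RHS]mulr1 -D1 /D; ring.
have M01 : M 0 1 = - M 1 0.
  transitivity (M 0 1 * (M 0 0 * M 0 0 + M 1 0 * M 1 0) -
    M 0 0 * (M 0 0 * M 0 1 + M 1 0 * M 1 1)); first by rewrite h1 h2; ring.
  by rewrite -[RHS]mulr1 -D1 /D; ring.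
have [t [ct st]] : exists t, cos t = M 0 0 /\ sin t = M 1 0.
  by apply: angle_exists; rewrite !expr2.
(* In Brinkmann coordinates, conjugation by (t, v, 0) maps w at time s to rho(t) w + (rho(-s/2) -
   rho(s/2)) v. The difference of rotations is - S(s) times the quarter turn, so v is the quarter
   turn of b. *)
exists (vec4 t (- b 1 0) (b 0 0) 0).
pose F y := brinkmann0 d (inner_aut (G0 R) (vec4 t (- b 1 0) (b 0 0) 0) (brinkmann0_inv d y)).
have FE0 y : F y 0 0 = y 0 0 by rewrite vec4E inner_aut0E0 vec4E.
have FE (y : 'rV[R]_4) : let h := 2^-1 * y 0 0 in let x := brinkmann0_inv d y in
    F y 0 1 = cos h * (- b 1 0 + (cos t * x 0 1 - sin t * x 0 2)
      + cos (y 0 0) * b 1 0 + sin (y 0 0) * b 0 0)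
      + sin h * (b 0 0 + (sin t * x 0 1 + cos t * x 0 2) 
      + sin (y 0 0) * b 1 0 - cos (y 0 0) * b 0 0) /\
    F y 0 2 = - sin h * (- b 1 0 + (cos t * x 0 1 - sin t * x 0 2)
      + cos (y 0 0) * b 1 0 + sin (y 0 0) * b 0 0)
      + cos h * (b 0 0 + (sin t * x 0 1 + cos t * x 0 2) 
      + sin (y 0 0) * b 1 0 - cos (y 0 0) * b 0 0).
  by split; rewrite vec4E inner_aut0E0 inner_aut0E1 inner_aut0E2 vec4E; ring.
have Fe x1 x2 : F (vec4 0 x1 x2 0) 0 1 = M 0 0 * x1 - M 1 0 * x2 /\
    F (vec4 0 x1 x2 0) 0 2 = M 1 0 * x1 + M 0 0 * x2.
  have [-> ->] := FE (vec4 0 x1 x2 0).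
  by rewrite /brinkmann0_inv !vec4E mulr0 cos0 sin0 ct st; split; ring.
have Fpi : F (vec4 pi 0 0 0) 0 1 = 2 * b 0 0 /\ F (vec4 pi 0 0 0) 0 2 = 2 * b 1 0.
  have [-> ->] := FE (vec4 pi 0 0 0).
  rewrite /brinkmann0_inv !vec4E cospi sinpi [2^-1 * _]mulrC cos_pihalf sin_pihalf.
  by split; ring.
have piE : pi *: vec4 1 0 0 0 = vec4 pi 0 0 0 :> 'rV[R]_4.
  by rewrite [LHS]vec4_eta !mxE /=; congr vec4; ring.
change (pw_param S_rot pi F = (1, M, b)); rewrite /pw_param S_rot_pi FE0 piE vec4E.
congr (_, _, _).
- apply: mx2P; rewrite mxE /=.
  + by rewrite (Fe 1 0).1; ring.
  + by rewrite (Fe 0 1).1 M01; ring.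
  + by rewrite (Fe 1 0).2; ring.
  + by rewrite (Fe 0 1).2 M11; ring.
- apply/colP => i; rewrite mxE; have [->|->] : i = 0 \/ i = 1.
  + by case: i => -[|[|//]] hi; [left|right]; exact: val_inj.
  + by rewrite Fpi.1; field.
  + by rewrite Fpi.2; field.
Qed.

(** Here [chi] is the sum of the entries: on diag(r, 1/r) it is r + 1/r, which has the sign of r and
    so detects the boosts among the isometries of positive determinant. *)
Let realize1 d M b : OJ 0 1 0 M -> 0 < \det M ->
  0 < M 0 0 + M 0 1 + M 1 0 + M 1 1 ->
  exists q, pw_param S_boost 1
    (fun y => brinkmann1 d (inner_aut (G1 R) q (brinkmann1_inv d y))) = (1, M, b).
Proof.
rewrite det2 => /O11_entries[h1 h2 h3] D0 s0.
(* If the diagonal product vanished, [h3] would make the determinant -1; so M is diagonal. *)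
have [M10 M01] : M 1 0 = 0 /\ M 0 1 = 0.
  have D00 : M 0 0 * M 1 1 != 0.
    apply: contraTneq D0 => D00; rewrite D00 sub0r oppr_gt0 -leNgt.
    by move: h3; rewrite D00 add0r => ->; exact: ler01.
  move: D00; rewrite mulf_eq0 negb_or => /andP[m0 m1].
  by split; [apply: (mulfI m0)|apply: (mulIf m1)]; rewrite ?h1 ?h2 ?mulr0 ?mul0r.
rewrite M10 M01 mulr0 addr0 in h3; rewrite M10 M01 !addr0 in s0.
have m00 : 0 < M 0 0 by nra.
have lnE : expR (ln (M 0 0)) = M 0 0 by rewrite lnK// posrE.
have M11 : expR (- ln (M 0 0)) = M 1 1.
  by rewrite expRN lnE -[LHS]mulr1 -h3 mulKf// gt_eqF.
set t := ln _ in lnE M11.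
(* Conjugation by (t, v, 0) adds - S(s) v1 and S(s) v2 to the two Brinkmann coordinates at time s,
   with opposite signs because e0 scales e1 and e2 by inverse factors. *)
exists (vec4 t (- b 0 0) (b 1 0) 0).
pose F y := brinkmann1 d (inner_aut (G1 R) (vec4 t (- b 0 0) (b 1 0) 0) (brinkmann1_inv d y)).
have FE0 y : F y 0 0 = y 0 0 by rewrite vec4E inner_aut1E0 vec4E.
have FE (y : 'rV[R]_4) : let h := 2^-1 * y 0 0 in let x := brinkmann1_inv d y in
    F y 0 1 = expR (- h) * (- b 0 0 + M 0 0 * x 0 1 + expR (y 0 0) * b 0 0) /\
    F y 0 2 = expR h * (b 1 0 + M 1 1 * x 0 2 - expR (- y 0 0) * b 1 0).
  split; rewrite vec4E inner_aut1E0 ?inner_aut1E1 ?inner_aut1E2 vec4E ?lnE ?M11; ring.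
have Fe x1 x2 : F (vec4 0 x1 x2 0) 0 1 = M 0 0 * x1 /\
    F (vec4 0 x1 x2 0) 0 2 = M 1 1 * x2.
  have [-> ->] := FE (vec4 0 x1 x2 0).
  by rewrite /brinkmann1_inv !vec4E mulr0 oppr0 expR0; split; ring.
have F1 : F (vec4 1 0 0 0) 0 1 = S_boost 1 * b 0 0 /\ F (vec4 1 0 0 0) 0 2 = S_boost 1 * b 1 0.
  have [-> ->] := FE (vec4 1 0 0 0).
  rewrite /brinkmann1_inv /S_boost !vec4E mulr1.
  have e1 : 1 = 2^-1 + 2^-1 :> R by field.
  have ee := expRxMexpNx_1 (2^-1 : R).
  rewrite [X in expR X * b 0 0]e1 [X in expR (- X) * b 1 0]e1 opprD !expRD.
  by split; ring: ee.
change (pw_param S_boost 1 F = (1, M, b)); rewrite /pw_param FE0 scale1r vec4E.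
congr (_, _, _).
- apply: mx2P; rewrite mxE /=.
  + by rewrite (Fe 1 0).1; ring.
  + by rewrite (Fe 0 1).1 M01; ring.
  + by rewrite (Fe 1 0).2 M10; ring.
  + by rewrite (Fe 0 1).2; ring.
- apply/colP => i; rewrite mxE mulr1; have [->|->] : i = 0 \/ i = 1.
  + by case: i => -[|[|//]] hi; [left|right]; exact: val_inj.
  + by rewrite F1.1 mulKf.
  + by rewrite F1.2 mulKf.
Qed.

Lemma isotropy_G0 (G : lieGroup R 4) g : bi_invariant_metric G g ->
  lie_isomorphic G (G0 R) ->
  topological_group_isomorphic (isotropy G g) (@compose R 4)
    (semidirect (@O2 R)) (@semidirect_mul R) /\
  connected_component (isotropy G g) id = inner_automorphisms G.
Proof.
move=> hg iso; rewrite -OJ_O2.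
have k0 : - 4^-1 != 0 :> R by rewrite oppr_eq0.
have j0 : 1 * 1 - 0 ^+ 2 != 0 :> R by rewrite mulr1 expr0n subr0 oner_neq0.
have s0 : S_rot pi != 0 by rewrite S_rot_pi pnatr_eq0.
have br1 d : brinkmann0 d (lone (G0 R)) = 0.
  rewrite /brinkmann0 /= !mxE !mulr0 [RHS]vec4_eta !mxE.
  by congr vec4; ring.
split.
  exact: (model_isotropy_isomorphic k0 j0 dS_rot dC_rot S_rot0 C_rot0 s0
    (@smooth_brinkmann0 R) (@smooth_brinkmann0_inv R) (@brinkmann0K R) (@brinkmann0_invK R) br1
    (@brinkmann0_metric R) (@invariant_form0 R) hg iso).
apply: (model_component k0 j0 dS_rot dC_rot S_rot0 C_rot0 s0
    (@smooth_brinkmann0 R) (@smooth_brinkmann0_inv R) (@brinkmann0K R) (@brinkmann0_invK R) br1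
    (@brinkmann0_metric R) (@invariant_form0 R) _ _ _ realize0 hg iso).
- have cm := @param_mx_continuous R.
  under eq_fun do rewrite det2.
  by move=> z; exact: (cvgB (cvgM (cm 0 0 z) (cm 1 1 z)) (cvgM (cm 0 1 z) (cm 1 0 z))).
- by move=> M /(OJ_unit j0); rewrite unitmxE unitfE.
- by rewrite det1 ltr01.
Qed.

Lemma isotropy_G1 (G : lieGroup R 4) g : bi_invariant_metric G g ->
  lie_isomorphic G (G1 R) ->
  topological_group_isomorphic (isotropy G g) (@compose R 4)
    (semidirect (@O11 R)) (@semidirect_mul R) /\
  connected_component (isotropy G g) id = inner_automorphisms G.
Proof.
move=> hg iso; rewrite -OJ_O11.
have j0 : 0 * 0 - 1 ^+ 2 != 0 :> R.
  by rewrite mulr0 expr1n sub0r oppr_eq0 oner_neq0.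
have br1 d : brinkmann1 d (lone (G1 R)) = 0.
  rewrite /brinkmann1 /= !mxE !mulr0 [RHS]vec4_eta !mxE.
  by congr vec4; ring.
split.
  exact: (model_isotropy_isomorphic quarter_neq0 j0 dS_boost dC_boost S_boost0 C_boost0
    S_boost1 (@smooth_brinkmann1 R) (@smooth_brinkmann1_inv R) (@brinkmann1K R) (@brinkmann1_invK R) br1
    (@brinkmann1_metric R) (@invariant_form1 R) hg iso).
apply: (model_component quarter_neq0 j0 dS_boost dC_boost S_boost0 C_boost0
    S_boost1 (@smooth_brinkmann1 R) (@smooth_brinkmann1_inv R) (@brinkmann1K R) (@brinkmann1_invK R) br1
    (@brinkmann1_metric R) (@invariant_form1 R) _ _ _ realize1 hg iso).
- have cm := @param_mx_continuous R.
  by move=> z; exact: (cvgD (cvgD (cvgD (cm 0 0 z) (cm 0 1 z)) (cm 1 0 z)) (cm 1 1 z)).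
- move=> M OM; have D : \det M != 0 by have := OJ_unit j0 OM; rewrite unitmxE unitfE.
  have [h1 h2 h3] := (O11_entries M).1 OM.
  apply/eqP => s; rewrite det2 in D.
  (* By [h1], [h2] and [h3] this square equals (M 0 0 + M 0 1)^2 + (M 1 0 + M 1 1)^2 + 2, which is
     positive. *)
  have : (M 0 0 + M 0 1 + M 1 0 + M 1 1) ^+ 2 = 0 by rewrite s expr0n.
  nra.
- by rewrite !mxE /=; lra.
Qed.

End Models.

Theorem theorem4p2 (R : realType) (G : lieGroup R 4) (g : 'rV[R]_4 -> 'M[R]_4)
    (hg : bi_invariant_metric G g) :
  [/\ lie_isomorphic G (G0 R) ->
        topological_group_isomorphic (isotropy G g) (@compose R 4)
          (semidirect (@O2 R)) (@semidirect_mul R),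
      lie_isomorphic G (G1 R) ->
        topological_group_isomorphic (isotropy G g) (@compose R 4)
          (semidirect (@O11 R)) (@semidirect_mul R) &
      lie_isomorphic G (G0 R) \/ lie_isomorphic G (G1 R) ->
        connected_component (isotropy G g) id = inner_automorphisms G].
Proof.
split=> [iso|iso|[] iso].
- by have [] := isotropy_G0 hg iso.
- by have [] := isotropy_G1 hg iso.
- by have [] := isotropy_G0 hg iso.
- by have [] := isotropy_G1 hg iso.
Qed.
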